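(* Let $\Bbbk$ be a commutative ring, and let $S=\psi_1\psi_2\psi_3:\Lambda\to\Lambda$ (composition of maps, $\psi_3$ applied first). With its multiplication, comultiplication, unit and counit, and with $S$ as antipode, $\Lambda$ has the structure of a non-involutory $\mathbb{Z}$-graded Hopf superalgebra, that is, a Hopf algebra object in the category of $\mathbb{Z}$-graded $\Bbbk$-modules with braiding $v\otimes w\mapsto(-1)^{\deg(v)\deg(w)}w\otimes v$, with $S^2\neq 1$. The $\mathbb{Z}$-grading is compatible in the sense that the super-grading is the mod $2$ reduction of the $\mathbb{Z}$-grading. Moreover, for every partition $\lambda$, $$\psi_1\psi_2(h_\lambda)=(-1)^{\binom{\lambda}{2}+|\lambda|}e_\lambda,\qquad \psi_1\psi_2(e_\lambda)=(-1)^{\binom{\lambda}{2}+|\lambda|}h_\lambda,\qquad S(h_\lambda)=(-1)^{\binom{|\lambda|+1}{2}}e_{\lambda^{\mathrm{rev}}}.$$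
   Context: The algebra of odd symmetric functions over the commutative ground ring $\Bbbk$: let $\Lambda'$ be the free associative $\mathbb{Z}$-graded $\Bbbk$-algebra on $h_1,h_2,\dots$ with $\deg h_n=n$; set $h_0=1$, $h_n=0$ for $n<0$. Give $\Lambda'\otimes\Lambda'$ the multiplication $(x_1\otimes x_2)(y_1\otimes y_2)=(-1)^{\deg(x_2)\deg(y_1)}x_1y_1\otimes x_2y_2$ on homogeneous elements; the comultiplication $\Delta:\Lambda'\to\Lambda'\otimes\Lambda'$ is the algebra homomorphism with $\Delta(h_n)=\sum_{m=0}^n h_m\otimes h_{n-m}$, and the counit $\epsilon$ is the algebra homomorphism to $\Bbbk$ that kills all elements of positive degree. For a composition $\alpha=(a_1,\dots,a_k)$ (finite sequence of positive integers) put $h_\alpha=h_{a_1}\cdots h_{a_k}$, $|\alpha|=a_1+\dots+a_k$, $S_\alpha=S_{a_1}\times\dots\times S_{a_k}\subset S_{|\alpha|}$ (a parabolic subgroup of the symmetric group). The symmetric $\Bbbk$-bilinear form on $\Lambda'$ is $(h_\beta,h_\alpha)=\sum_{c\in S_\beta\backslash S_n/S_\alpha}(-1)^{\ell(c)}$ if $|\alpha|=|\beta|=n$, and $0$ if $|\alpha|\ne|\beta|$, where $\ell(c)$ is the Coxeter length of the minimal length element of the double coset $c$. Let $\mathcal I$ be the radical of the form and $\Lambda=\Lambda'/\mathcal I$, with the induced grading, multiplication, comultiplication, unit, counit and form. Elements $e_n\in\Lambda$ are defined by $e_0=1$ and $\sum_{k=0}^n(-1)^{\binom{k+1}{2}}e_kh_{n-k}=0$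 for $n\ge1$; for a composition $\alpha=(a_1,\dots,a_r)$ (in particular for a partition), $e_\alpha=e_{a_1}\cdots e_{a_r}$, $\binom{\alpha}{2}=\sum_i\binom{a_i}{2}$, and $\alpha^{\mathrm{rev}}=(a_r,\dots,a_1)$. The following maps $\Lambda\to\Lambda$ are well defined: $\psi_1$ is the algebra homomorphism with $\psi_1(h_n)=e_n$; $\psi_2$ is the algebra homomorphism with $\psi_2(h_n)=(-1)^{\binom{n+1}{2}}h_n$; $\psi_3$ is the $\Bbbk$-linear superalgebra anti-homomorphism with $\psi_3(h_n)=h_n$, i.e. $\psi_3(xy)=(-1)^{\deg(x)\deg(y)}\psi_3(y)\psi_3(x)$ for homogeneous $x,y$.
   Formalization: The claim S^2 ≠ 1 is proved only when 2 ≠ 0 in the ground ring; it fails when 2 = 0 (for instance over F_2, where Λ is commutative and S^2 = 1). All other claims are proved for every nonzero commutative ring. *)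

(* Defs.v *)
From HB Require Import structures.
From mathcomp Require Import all_boot all_order all_algebra all_fingroup.
From mathcomp Require Import finmap.
From mathcomp.multinomials Require Import monalg.
From mathcomp Require Import boolp classical_sets.

Set Implicit Arguments.
Unset Strict Implicit.
Unset Printing Implicit Defensive.

Import GRing.Theory.

Local Open Scope ring_scope.

(* A tensor is a finite formal sum of pairs (x, y), read as a sum of pure     *)
(* tensors, two formal sums being identified when no bilinear map separates   *)
(* them.  Scalars need no separate coefficient, since a (x ⊗ y) = (a x) ⊗ y.  *)
Section TensorProduct.
Context (k : comNzRingType) (M N : lmodType k).

Definition bilin_eval (P : lmodType k) (f : M -> N -> P) (s : seq (M * N)) : P :=
  \sum_(p <- s) f p.1 p.2.

Definition tensor_rel (s t : seq (M * N)) : Prop :=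
  forall (P : lmodType k) (f : M -> N -> P),
    bilinear_for *:%R *:%R f -> bilin_eval f s = bilin_eval f t.

Definition tensor_eqv : rel (seq (M * N)) := fun s t => `[< tensor_rel s t >].

Lemma tensor_eqv_refl : reflexive tensor_eqv.
Proof. by move=> s; apply/asboolP. Qed.

Lemma tensor_eqv_sym : symmetric tensor_eqv.
Proof.
by move=> s t; apply/asboolP/asboolP => h P f fP; rewrite h.
Qed.

Lemma tensor_eqv_trans : transitive tensor_eqv.
Proof.
move=> t s u /asboolP st /asboolP tu; apply/asboolP => P f fP.
by rewrite st // tu.
Qed.

Canonical tensor_equiv :=
  EquivRel tensor_eqv tensor_eqv_refl tensor_eqv_sym tensor_eqv_trans.

Definition tensor := {eq_quot tensor_equiv}%qT.

HB.instance Definition _ := Choice.on tensor.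

Definition tensor_cls (s : seq (M * N)) : tensor := (\pi_{eq_quot tensor_equiv} s)%qT.
Definition tensor_repr (t : tensor) : seq (M * N) :=
  (@generic_quotient.repr _ {eq_quot tensor_equiv} t)%qT.

Lemma tensor_reprK t : tensor_cls (tensor_repr t) = t.
Proof. exact: reprK. Qed.

Lemma tensor_clsP s t : tensor_cls s = tensor_cls t <-> tensor_rel s t.
Proof.
split=> [/eqquotP/asboolP //|st].
by apply/eqquotP/asboolP.
Qed.

Lemma tensor_cls_repr s : tensor_rel (tensor_repr (tensor_cls s)) s.
Proof. by apply/tensor_clsP; rewrite tensor_reprK. Qed.

Definition tensor_add (t u : tensor) : tensor :=
  tensor_cls (tensor_repr t ++ tensor_repr u).
Definition tensor_scale (a : k) (t : tensor) : tensor :=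
  tensor_cls [seq (a *: p.1, p.2) | p <- tensor_repr t].
Definition tensor_opp (t : tensor) : tensor :=
  tensor_cls [seq (- p.1, p.2) | p <- tensor_repr t].

Lemma bilin_eval_cat (P : lmodType k) (f : M -> N -> P) s t :
  bilin_eval f (s ++ t) = bilin_eval f s + bilin_eval f t.
Proof. by rewrite /bilin_eval big_cat. Qed.

Lemma bilin_eval_scale (P : lmodType k) (f : M -> N -> P) a s :
  bilinear_for *:%R *:%R f ->
  bilin_eval f [seq (a *: p.1, p.2) | p <- s] = a *: bilin_eval f s.
Proof.
case=> fl _; rewrite /bilin_eval big_map scaler_sumr; apply: eq_bigr => p _ /=.
have f0 : f 0 p.2 = 0.
  by have := fl p.2 (-1) 0 0; rewrite /= scaleN1r addNr scaleN1r addNr.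
by have := fl p.2 a p.1 0; rewrite /= !addr0 f0 addr0.
Qed.

Lemma bilin_eval_opp (P : lmodType k) (f : M -> N -> P) s :
  bilinear_for *:%R *:%R f ->
  bilin_eval f [seq (- p.1, p.2) | p <- s] = - bilin_eval f s.
Proof.
move=> fP; rewrite -scaleN1r -bilin_eval_scale //.
by congr bilin_eval; apply: eq_map => p; rewrite scaleN1r.
Qed.

Lemma tensor_ext (t u : tensor) :
  (forall (P : lmodType k) (f : M -> N -> P), bilinear_for *:%R *:%R f ->
     bilin_eval f (tensor_repr t) = bilin_eval f (tensor_repr u)) -> t = u.
Proof. by move=> h; rewrite -[t]tensor_reprK -[u]tensor_reprK; apply/tensor_clsP. Qed.

Lemma eval_add (P : lmodType k) (f : M -> N -> P) t u :
  bilinear_for *:%R *:%R f ->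
  bilin_eval f (tensor_repr (tensor_add t u)) =
  bilin_eval f (tensor_repr t) + bilin_eval f (tensor_repr u).
Proof. by move=> fP; rewrite tensor_cls_repr // bilin_eval_cat. Qed.

Lemma eval_scale (P : lmodType k) (f : M -> N -> P) a t :
  bilinear_for *:%R *:%R f ->
  bilin_eval f (tensor_repr (tensor_scale a t)) =
  a *: bilin_eval f (tensor_repr t).
Proof. by move=> fP; rewrite tensor_cls_repr // bilin_eval_scale. Qed.

Lemma eval_opp (P : lmodType k) (f : M -> N -> P) t :
  bilinear_for *:%R *:%R f ->
  bilin_eval f (tensor_repr (tensor_opp t)) = - bilin_eval f (tensor_repr t).
Proof. by move=> fP; rewrite tensor_cls_repr // bilin_eval_opp. Qed.

Lemma eval_zero (P : lmodType k) (f : M -> N -> P) :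
  bilinear_for *:%R *:%R f -> bilin_eval f (tensor_repr (tensor_cls [::])) = 0.
Proof. by move=> fP; rewrite tensor_cls_repr // /bilin_eval big_nil. Qed.

Lemma tensor_addA : associative tensor_add.
Proof. by move=> t u v; apply: tensor_ext => P f fP; rewrite !eval_add // addrA. Qed.
Lemma tensor_addC : commutative tensor_add.
Proof. by move=> t u; apply: tensor_ext => P f fP; rewrite !eval_add // addrC. Qed.
Lemma tensor_add0 : left_id (tensor_cls [::]) tensor_add.
Proof.
by move=> t; apply: tensor_ext => P f fP; rewrite eval_add // eval_zero // add0r.
Qed.
Lemma tensor_addN : left_inverse (tensor_cls [::]) tensor_opp tensor_add.
Proof.
move=> t; apply: tensor_ext => P f fP.
by rewrite eval_add // eval_zero // eval_opp // addNr.
Qed.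

HB.instance Definition _ := GRing.isZmodule.Build tensor
  tensor_addA tensor_addC tensor_add0 tensor_addN.

Lemma tensor_scaleA a b (t : tensor) :
  tensor_scale a (tensor_scale b t) = tensor_scale (a * b) t.
Proof. by apply: tensor_ext => P f fP; rewrite !eval_scale // scalerA. Qed.
Lemma tensor_scale1 : left_id 1 tensor_scale.
Proof. by move=> t; apply: tensor_ext => P f fP; rewrite eval_scale // scale1r. Qed.
Lemma tensor_scaleDr : right_distributive tensor_scale +%R.
Proof.
move=> a t u; apply: tensor_ext => P f fP.
by rewrite !(eval_scale, eval_add) // scalerDr.
Qed.
Lemma tensor_scaleDl (t : tensor) :
  {morph tensor_scale^~ t : a b / a + b}.
Proof.
move=> a b; apply: tensor_ext => P f fP.
by rewrite !(eval_scale, eval_add) // scalerDl.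
Qed.

HB.instance Definition _ := GRing.Zmodule_isLmodule.Build k tensor
  tensor_scaleA tensor_scale1 tensor_scaleDr tensor_scaleDl.

Definition pure (x : M) (y : N) : tensor := tensor_cls [:: (x, y)].

(* Only meaningful for bilinear f, see tensor_lift_pure. *)
Definition tensor_lift (P : lmodType k) (f : M -> N -> P) (t : tensor) : P :=
  bilin_eval f (tensor_repr t).

Lemma tensor_lift_pure (P : lmodType k) (f : M -> N -> P) x y :
  bilinear_for *:%R *:%R f -> tensor_lift f (pure x y) = f x y.
Proof. by move=> fP; rewrite /tensor_lift tensor_cls_repr // /bilin_eval big_seq1. Qed.

Lemma tensor_lift_linear (P : lmodType k) (f : M -> N -> P) :
  bilinear_for *:%R *:%R f -> linear (tensor_lift f).
Proof.
move=> fP a t u; rewrite /tensor_lift -[a *: t]/(tensor_scale a t).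
by rewrite -[_ + u]/(tensor_add _ u) eval_add // eval_scale.
Qed.

Lemma pure_bilinear : bilinear_for *:%R *:%R pure.
Proof.
have addE (t u : tensor) : t + u = tensor_add t u by [].
have scaleE a (t : tensor) : a *: t = tensor_scale a t by [].
split=> [y a x x'|x a y y'] /=; rewrite addE scaleE; apply: tensor_ext => P f fP.
  rewrite eval_add // eval_scale // !tensor_cls_repr // /bilin_eval !big_seq1 /=.
  by case: fP => fl _; apply: fl.
rewrite eval_add // eval_scale // !tensor_cls_repr // /bilin_eval !big_seq1 /=.
by case: fP => _ fr; apply: fr.
Qed.

Lemma tensor_pure_sum (t : tensor) :
  t = \sum_(p <- tensor_repr t) pure p.1 p.2.
Proof.
rewrite -[t in LHS]tensor_reprK; elim: (tensor_repr t) => [|p s ih].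
  by rewrite big_nil.
rewrite big_cons -ih; apply: tensor_ext => P f fP.
rewrite -[pure _ _ + _]/(tensor_add _ _) eval_add // !tensor_cls_repr //.
by rewrite /bilin_eval big_cons big_seq1.
Qed.

End TensorProduct.

Notation "M ⊗ N" := (tensor M%type N%type) (at level 40, left associativity) : type_scope.
Notation "x ⊗ y" := (pure x y) (at level 40, left associativity) : ring_scope.

Definition tensor_map (k : comNzRingType) (M N M' N' : lmodType k)
    (f : M -> M') (g : N -> N') : M ⊗ N -> M' ⊗ N' :=
  tensor_lift (fun x y => f x ⊗ g y).

(* (x ⊗ y) ⊗ z |-> x ⊗ (y ⊗ z) *)
Definition tensor_assoc (k : comNzRingType) (M N P : lmodType k) :
    (M ⊗ N) ⊗ P -> M ⊗ (N ⊗ P) :=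
  tensor_lift (fun t z => tensor_lift (fun x y => x ⊗ (y ⊗ z)) t).

(* A grading is given by its homogeneous components: deg n x means that x is  *)
(* homogeneous of degree n (or zero).                                         *)
Section Graded.
Context (k : comNzRingType).

Definition is_grading (V : lmodType k) (deg : int -> V -> Prop) : Prop :=
  [/\ forall n, deg n 0,
      forall n a x y, deg n x -> deg n y -> deg n (a *: x + y),
      forall x, exists (s : seq int) (c : int -> V),
        (forall n, deg n (c n)) /\ x = \sum_(n <- s) c n
    & forall (s : seq int) (c : int -> V), uniq s -> (forall n, deg n (c n)) ->
        \sum_(n <- s) c n = 0 -> forall n, n \in s -> c n = 0].

Definition tensor_deg (V W : lmodType k) (degV : int -> V -> Prop)
    (degW : int -> W -> Prop) (n : int) (t : V ⊗ W) : Prop :=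
  exists2 s : seq (V * W),
    forall p, p \in s ->
      exists i j : int, [/\ i + j = n, degV i p.1 & degW j p.2]
  & t = \sum_(p <- s) p.1 ⊗ p.2.

(* The super-grading is the mod 2 reduction of the Z-grading deg. *)
Definition super_deg (V : lmodType k) (deg : int -> V -> Prop)
    (b : bool) (x : V) : Prop :=
  exists (s : seq int) (c : int -> V),
    [/\ forall n, n \in s -> odd `|n|%N = b, forall n, deg n (c n)
      & x = \sum_(n <- s) c n].

(* The component of x of parity b; it is unique when deg is a grading. *)
Definition super_part (V : lmodType k) (deg : int -> V -> Prop)
    (b : bool) (x : V) : V :=
  xget 0 [set y | super_deg deg b y /\ super_deg deg (~~ b) (x - y)].

(* v ⊗ w |-> (-1)^(|v| |w|) w ⊗ v for v, w homogeneous for the super-grading. *)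
Definition braiding (V W : lmodType k) (degV : int -> V -> Prop)
    (degW : int -> W -> Prop) : V ⊗ W -> W ⊗ V :=
  tensor_lift (fun v w => \sum_(a : bool) \sum_(b : bool)
    (-1) ^+ (a && b) *: (super_part degW b w ⊗ super_part degV a v)).

(* (x1 ⊗ x2)(y1 ⊗ y2) = (-1)^(|x2| |y1|) x1 y1 ⊗ x2 y2: braid x2 past y1, then *)
(* multiply.                                                                  *)
Definition tensor_mul (A : lalgType k) (deg : int -> A -> Prop)
    (t u : A ⊗ A) : A ⊗ A :=
  tensor_lift (fun x1 x2 =>
    tensor_lift (fun y1 y2 =>
      tensor_lift (fun y x => (x1 * y) ⊗ (x * y2))
        (braiding deg deg (x2 ⊗ y1))) u) t.

(* (A, Delta, eps, S) is a Hopf algebra object in the category of Z-graded    *)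
(* k-modules (with degree 0 morphisms) with the braiding above; k itself is   *)
(* concentrated in degree 0.                                                  *)
Record graded_Hopf_superalgebra (A : algType k) (deg : int -> A -> Prop)
    (Delta : A -> A ⊗ A) (eps : A -> k) (S : A -> A) : Prop := {
  gHs_grading : is_grading deg;
  gHs_braiding : forall m n v w, deg m v -> deg n w ->
    braiding deg deg (v ⊗ w) = (-1) ^+ `|(m * n)%R|%N *: (w ⊗ v);
  gHs_one_deg : deg 0 1;
  gHs_mul_deg : forall m n x y, deg m x -> deg n y -> deg (m + n) (x * y);
  gHs_Delta_linear : linear Delta;
  gHs_Delta_deg : forall n x, deg n x -> tensor_deg deg deg n (Delta x);
  gHs_eps_linear : scalar eps;
  gHs_eps_deg : forall n x, deg n x -> n != 0 -> eps x = 0;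
  gHs_S_linear : linear S;
  gHs_S_deg : forall n x, deg n x -> deg n (S x);
  gHs_coassoc : forall x,
    tensor_assoc (tensor_map Delta id (Delta x)) = tensor_map id Delta (Delta x);
  gHs_counitl : forall x, tensor_lift (fun a b => eps a *: b) (Delta x) = x;
  gHs_counitr : forall x, tensor_lift (fun a b => eps b *: a) (Delta x) = x;
  gHs_Delta1 : Delta 1 = 1 ⊗ 1;
  gHs_DeltaM : forall x y, Delta (x * y) = tensor_mul deg (Delta x) (Delta y);
  gHs_eps1 : eps 1 = 1;
  gHs_epsM : forall x y, eps (x * y) = eps x * eps y;
  gHs_antipodel : forall x,
    tensor_lift (fun a b => S a * b) (Delta x) = (eps x)%:A;
  gHs_antipoder : forall x,
    tensor_lift (fun a b => a * S b) (Delta x) = (eps x)%:A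
}.

End Graded.

Section Coxeter.
Context (n : nat).
Local Open Scope group_scope.

Definition simple_reflections : {set 'S_n} :=
  [set tperm p.1 p.2 | p in [set p : 'I_n * 'I_n | p.2 == p.1.+1 :> nat]].

Definition has_word (w : 'S_n) (m : nat) : bool :=
  [exists c : {ffun 'I_m -> 'S_n},
    [forall i, c i \in simple_reflections] && (w == \prod_(i < m) c i)].

Lemma tperm_simple (d : nat) (i j : 'I_n) :
  j = (i + d)%N :> nat -> tperm i j \in <<simple_reflections>>.
Proof.
elim: d j => [|d IHd] j jE.
  have -> : j = i by apply: val_inj; rewrite /= jE addn0.
  by rewrite tperm1 group1.
have lt_id : (i + d < n)%N by apply: leq_trans (ltn_ord j); rewrite jE addnS.
pose l := Ordinal lt_id.
have lj : tperm l j \in <<simple_reflections>>.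
  apply: mem_gen; apply/imsetP; exists (l, j) => //.
  by rewrite inE /= jE addnS.
case: (posnP d) => [d0|d_gt0].
  by have <- : l = i by apply: val_inj; rewrite /= d0 addn0.
have -> : tperm i j = tperm i l ^ tperm l j.
  rewrite tpermJ tpermL tpermD //; apply/eqP => /(congr1 val) /=; last first.
    by rewrite jE => /eqP; rewrite -[X in _ == X]addn0 eqn_add2l.
  by move/eqP; rewrite -[X in _ == X]addn0 eqn_add2l; case: (d) d_gt0.
by rewrite groupJ // IHd.
Qed.

Lemma has_wordP w : exists m, has_word w m.
Proof.
have : w \in <<simple_reflections>>.
  have [ts -> _] := prod_tpermP w; apply: group_prod => -[i j] _ /=.
  case: (leqP i j) => [le_ij|/ltnW le_ji].
    by apply: (@tperm_simple (j - i)); rewrite subnKC.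
  by rewrite tpermC; apply: (@tperm_simple (i - j)); rewrite subnKC.
case/gen_prodgP => m [c cS wE]; exists m; apply/existsP; exists [ffun i => c i].
apply/andP; split; first by apply/forallP => i; rewrite ffunE.
by rewrite wE; apply/eqP; apply: eq_bigr => i _; rewrite ffunE.
Qed.

Definition Coxeter_length (w : 'S_n) : nat := ex_minn (has_wordP w).

(* S_alpha, for sumn alpha = n: reshape_index alpha i is the block of i when  *)
(* {0, ..., n-1} is cut into consecutive blocks of sizes alpha.               *)
Definition Young (alpha : seq nat) : {set 'S_n} :=
  [set s : 'S_n | [forall i : 'I_n,
     reshape_index alpha (s i) == reshape_index alpha i]].

Definition double_cosets (beta alpha : seq nat) : {set {set 'S_n}} :=
  [set Young beta * [set w] * Young alpha | w : 'S_n].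

Definition double_coset_length (c : {set 'S_n}) : nat :=
  Coxeter_length [arg min_(w < repr c in c) Coxeter_length w].

End Coxeter.

Section FreeAlgebra.
Context (k : comNzRingType).

(* The letter i : nat stands for the generator h_(i+1), so that all words     *)
(* index compositions.                                                        *)
Definition composition_of (w : {fmonom nat}) : seq nat := map succn w.

Definition Lambda' := {malg k[{fmonom nat}]}.

HB.instance Definition _ := GRing.Lalgebra.on Lambda'.

Definition h' (n : nat) : Lambda' := if n is i.+1 then << fmu i >> else 1.

Definition deg' (n : int) (x : Lambda') : Prop :=
  forall w, w \in msupp x -> (sumn (composition_of w))%:Z = n.

Definition Delta'_gen (n : nat) : Lambda' ⊗ Lambda' :=
  \sum_(m < n.+1) h' m ⊗ h' (n - m)%N.

(* The algebra morphism to Lambda' ⊗ Lambda', multiplied by tensor_mul, with  *)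
(* h_n |-> Delta'_gen n.                                                      *)
Definition Delta' (x : Lambda') : Lambda' ⊗ Lambda' :=
  \sum_(w <- msupp x) x@_w *:
    foldr (fun n t => tensor_mul deg' (Delta'_gen n) t) (1 ⊗ 1)
      (composition_of w).

(* The coefficient of the empty word. *)
Definition eps' (x : Lambda') : k := x@_(mone : {fmonom nat}).

Definition form_h (beta alpha : seq nat) : k :=
  if sumn beta == sumn alpha then
    \sum_(c in double_cosets (sumn alpha) beta alpha)
      (-1) ^+ double_coset_length c
  else 0.

Definition form (x y : Lambda') : k :=
  \sum_(u <- msupp x) \sum_(v <- msupp y)
    x@_u * y@_v * form_h (composition_of u) (composition_of v).

Definition radical (x : Lambda') : Prop := forall y, form x y = 0.

End FreeAlgebra.

Arguments Lambda' k : clear implicits.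
Arguments h' {k} n.

Definition induced_deg (k : comNzRingType) (L : lmodType k)
    (pi : Lambda' k -> L) (n : int) (y : L) : Prop :=
  exists2 x, deg' n x & pi x = y.

Definition is_partition (la : seq nat) : bool := sorted geq la && (0 \notin la)%N.

Definition comp_prod (A : nzRingType) (u : nat -> A) (alpha : seq nat) : A :=
  \prod_(a <- alpha) u a.

Definition comp_bin2 (alpha : seq nat) : nat := (\sum_(a <- alpha) 'C(a, 2))%N.

(* Main.v *)
From HB Require Import structures.
Require Import Defs.
From mathcomp Require Import all_boot all_order all_algebra all_fingroup.
From mathcomp.multinomials Require Import monalg.
From mathcomp Require Import finmap boolp classical_sets.

(** The signed product of Λ ⊗ Λ is encoded by the parity operator
    σ x = (-1)^|x| x: for y homogeneous of degree p, left multiplication by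
    x ⊗ y is a ⊗ b |-> x σ^p(a) ⊗ y b, a tensor product of linear maps.  Left
    multiplication by Δ(h_n) is a sum of such maps, so coassociativity, the
    counit axioms and the multiplicativity of Δ follow by induction on words in
    the h_n.  For the antipode, S(h_n x) = S(σ^n x) S(h_n) reduces the axioms to
    the generators, where they say that the series Σ S(h_n) is a two-sided
    inverse of Σ h_n; one side is the recursion defining e_n.  Uniqueness of
    inverses also makes ψ1 ψ2 an involution.  Finally
    S^2(h_2) = h_2 - 2 h_1^2, and 2 h_1^2 is not in the radical because
    (h_1 h_1, h_2) = 1.  The radical is graded since distinct degrees are
    orthogonal. *)

Set Implicit Arguments.
Unset Strict Implicit.
Unset Printing Implicit Defensive.

Import GRing.Theory.

Local Open Scope ring_scope.

(** * Linear maps between tensor products *)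

Section TensorMaps.
Context (k : comNzRingType).
Implicit Types M N P Q : lmodType k.

Lemma linear_forE M P (f : M -> P) : linear f ->
  (f 0 = 0) * {morph f : x y / x + y} * (forall a, {morph f : x / a *: x}).
Proof.
move=> lf; have fD : {morph f : x y / x + y}.
  by move=> x y; have := lf 1 x y; rewrite !scale1r.
have f0 : f 0 = 0 by apply: (addrI (f 0)); rewrite -fD !addr0.
by do !split=> //; move=> a x; rewrite -[a *: x]addr0 lf f0 addr0.
Qed.

Lemma linear_for_sum M P (f : M -> P) (I : Type) (s : seq I) (F : I -> M) :
  linear f -> f (\sum_(i <- s) F i) = \sum_(i <- s) f (F i).
Proof.
move=> lf; apply: (big_morph f _ _) => [x y|]; by rewrite linear_forE.
Qed.

Lemma pure0l M N (y : N) : (0 : M) ⊗ y = 0.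
Proof. by have [pl _] := pure_bilinear M N; have [[]] := linear_forE (pl y). Qed.

Lemma tensor_ind M N (T : M ⊗ N -> Prop) :
  (forall a t u, T t -> T u -> T (a *: t + u)) ->
  (forall x y, T (x ⊗ y)) -> forall t, T t.
Proof.
move=> Tlin Tpure t; rewrite (tensor_pure_sum t).
(* The empty sum equals the pure tensor 0 ⊗ 0, which [Tpure] covers. *)
elim: (tensor_repr t) => [|p s IH]; first by rewrite big_nil -(pure0l M (0 : N)).
by rewrite big_cons -[_ ⊗ _]scale1r; apply: Tlin.
Qed.

Lemma bilinear_pure_map M N M' N' (f : {linear M -> M'}) (g : {linear N -> N'}) :
  bilinear_for *:%R *:%R (fun x y => f x ⊗ g y).
Proof.
have [pl pr] := pure_bilinear M' N'.
by split=> [y a x x'|x a y y']; rewrite /= linearP; [apply: pl | apply: pr].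
Qed.

Lemma tensor_mapE M N M' N' (f : {linear M -> M'}) (g : {linear N -> N'}) x y :
  tensor_map f g (x ⊗ y) = f x ⊗ g y.
Proof. by rewrite /tensor_map tensor_lift_pure //; apply: bilinear_pure_map. Qed.

Lemma tensor_map_is_linear M N M' N' (f : {linear M -> M'}) (g : {linear N -> N'}) :
  linear (tensor_map f g).
Proof. exact/tensor_lift_linear/bilinear_pure_map. Qed.

HB.instance Definition _ M N M' N' (f : {linear M -> M'}) (g : {linear N -> N'}) :=
  GRing.isLinear.Build k (M ⊗ N)%type (M' ⊗ N')%type *:%R (tensor_map f g)
    (tensor_map_is_linear f g).

Lemma tensor_map_comp M N M' N' M'' N''
    (f : {linear M' -> M''}) (g : {linear N' -> N''})
    (f' : {linear M -> M'}) (g' : {linear N -> N'}) t :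
  tensor_map f g (tensor_map f' g' t) = tensor_map (f \o f') (g \o g') t.
Proof.
elim/tensor_ind: t => [a t u IHt IHu|x y]; first by rewrite !linearP /= IHt IHu.
by rewrite !tensor_mapE.
Qed.

Lemma pureDl M N (x x' : M) (y : N) : (x + x') ⊗ y = x ⊗ y + x' ⊗ y.
Proof. by have [pl _] := pure_bilinear M N; have := pl y 1 x x'; rewrite /= !scale1r. Qed.
Lemma pureDr M N (x : M) (y y' : N) : x ⊗ (y + y') = x ⊗ y + x ⊗ y'.
Proof. by have [_ pr] := pure_bilinear M N; have := pr x 1 y y'; rewrite /= !scale1r. Qed.
Lemma pure0r M N (x : M) : x ⊗ (0 : N) = 0.
Proof. by apply: (addrI (x ⊗ 0)); rewrite -pureDr !addr0. Qed.
Lemma pureZl M N a (x : M) (y : N) : (a *: x) ⊗ y = a *: (x ⊗ y).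
Proof.
have [pl _] := pure_bilinear M N.
by have := pl y a x 0; rewrite /= pure0l !addr0.
Qed.
Lemma pureZr M N a (x : M) (y : N) : x ⊗ (a *: y) = a *: (x ⊗ y).
Proof.
have [_ pr] := pure_bilinear M N.
by have := pr x a y 0; rewrite /= pure0r !addr0.
Qed.
Lemma pure_suml M N (I : Type) (s : seq I) (F : I -> M) (y : N) :
  (\sum_(i <- s) F i) ⊗ y = \sum_(i <- s) F i ⊗ y.
Proof. by apply: (big_morph (fun x => x ⊗ y)) => [x x'|]; rewrite ?pureDl ?pure0l. Qed.
Lemma pure_sumr M N (I : Type) (s : seq I) (F : I -> N) (x : M) :
  x ⊗ (\sum_(i <- s) F i) = \sum_(i <- s) x ⊗ F i.
Proof. by apply: (big_morph (fun y => x ⊗ y)) => [y y'|]; rewrite ?pureDr ?pure0r. Qed.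

Lemma bilinear_assoc M N P (z : P) :
  bilinear_for *:%R *:%R (fun (x : M) (y : N) => x ⊗ (y ⊗ z)).
Proof.
by split=> [y a x x'|x a y y'] /=; rewrite !(pureDl, pureDr, pureZl, pureZr).
Qed.

Lemma bilinear_tensor_assoc M N P :
  bilinear_for *:%R *:%R
    (fun (t : M ⊗ N) (z : P) => tensor_lift (fun x y => x ⊗ (y ⊗ z)) t).
Proof.
split=> [z|t] /=; first exact/tensor_lift_linear/bilinear_assoc.
move=> a z z'; rewrite /tensor_lift /bilin_eval scaler_sumr -big_split /=.
by apply: eq_bigr => p _; rewrite !pureDr !pureZr.
Qed.

Lemma tensor_assocE M N P (x : M) (y : N) (z : P) :
  tensor_assoc ((x ⊗ y) ⊗ z) = x ⊗ (y ⊗ z).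
Proof.
rewrite /tensor_assoc tensor_lift_pure; last exact: bilinear_tensor_assoc.
by rewrite tensor_lift_pure //; apply: bilinear_assoc.
Qed.

Lemma tensor_assoc_is_linear M N P : linear (@tensor_assoc k M N P).
Proof. exact/tensor_lift_linear/bilinear_tensor_assoc. Qed.

HB.instance Definition _ M N P :=
  GRing.isLinear.Build k ((M ⊗ N) ⊗ P)%type (M ⊗ (N ⊗ P))%type *:%R (@tensor_assoc k M N P)
    (@tensor_assoc_is_linear M N P).

Lemma tensor_assoc_map M N P M' N' P' (f : {linear M -> M'})
    (g : {linear N -> N'}) (h : {linear P -> P'}) t :
  tensor_assoc (tensor_map (tensor_map f g) h t)
  = tensor_map f (tensor_map g h) (tensor_assoc t).
Proof.
elim/tensor_ind: t => [a t u IHt IHu|t z]; first by rewrite !linearP /= IHt IHu.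
rewrite tensor_mapE /=; elim/tensor_ind: t => [a t u IHt IHu|x y].
  by rewrite linearP !(pureDl, pureZl) !linearP /= IHt IHu.
by rewrite tensor_mapE !tensor_assocE tensor_mapE /= tensor_mapE.
Qed.

End TensorMaps.

(** * Gradings and their even and odd parts *)

Section Gradings.
Context (k : comNzRingType) (V : lmodType k) (deg : int -> V -> Prop).
Hypothesis deg_grading : is_grading deg.

Lemma deg0 n : deg n 0.
Proof. by case: deg_grading. Qed.

Lemma degP n a x y : deg n x -> deg n y -> deg n (a *: x + y).
Proof. by case: deg_grading => _ + _ _; apply. Qed.

Lemma degD n x y : deg n x -> deg n y -> deg n (x + y).
Proof. by move=> dx dy; rewrite -[x]scale1r; apply: degP. Qed.

Lemma degZ n a x : deg n x -> deg n (a *: x).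
Proof. by move=> dx; rewrite -[_ *: _]addr0; apply: degP => //; apply: deg0. Qed.

Lemma degB n x y : deg n x -> deg n y -> deg n (x - y).
Proof. by move=> dx dy; apply: degD => //; rewrite -scaleN1r; apply: degZ. Qed.

Lemma degMn n x m : deg n x -> deg n (x *+ m).
Proof. by move=> dx; rewrite -scaler_nat; apply: degZ. Qed.

Lemma deg_sum n (I : Type) (s : seq I) (P : pred I) (F : I -> V) :
  (forall i, P i -> deg n (F i)) -> deg n (\sum_(i <- s | P i) F i).
Proof. by move=> dF; apply: (big_ind (deg n)) => //; [apply: deg0 | apply: degD]. Qed.

Lemma homogeneous_ind (T : V -> Prop) :
  (forall x y, T x -> T y -> T (x + y)) ->
  (forall n x, deg n x -> T x) -> forall x, T x.
Proof.
case: deg_grading => _ _ + _ TD Thom x => /(_ x)[s [c [dc ->]]].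
by apply: big_ind => // [|n _]; apply: Thom; [apply: (deg0 0) | apply: dc].
Qed.

(** The independence clause of [is_grading] concerns duplicate-free lists only, while the lists in
    [super_deg] may repeat degrees. Multiplicities bring two decompositions to a common list of
    distinct degrees. *)
Lemma big_count (s r : seq int) (c : int -> V) : uniq r -> {subset s <= r} ->
  \sum_(n <- s) c n = \sum_(n <- r) c n *+ count_mem n s.
Proof.
move=> ur; elim: s => [|m s IH] sr.
  by rewrite big_nil big1 // => n _.
rewrite big_cons IH => [|n ns]; last by apply: sr; rewrite inE ns orbT.
under [RHS]eq_bigr => n _ do rewrite mulrnDr.
rewrite big_split; congr (_ + _); rewrite (bigD1_seq m) ?sr ?inE ?eqxx //= big1 ?addr0 // => n.
by rewrite eq_sym => /negPf ->.
Qed.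

Lemma super_degP b a x y :
  super_deg deg b x -> super_deg deg b y -> super_deg deg b (a *: x + y).
Proof.
move=> [s [c [sb dc ->]]] [s' [c' [sb' dc' ->]]].
exists (undup (s ++ s')).
exists (fun n => a *: (c n *+ count_mem n s) + c' n *+ count_mem n s').
split=> [n|n|]; first by rewrite mem_undup mem_cat => /orP[/sb|/sb'].
  by apply: degP; apply: degMn.
rewrite (@big_count s (undup (s ++ s'))) ?undup_uniq // => [|n ns]; last first.
  by rewrite mem_undup mem_cat ns.
rewrite (@big_count s' (undup (s ++ s'))) ?undup_uniq // => [|n ns]; last first.
  by rewrite mem_undup mem_cat ns orbT.
by rewrite scaler_sumr -big_split.
Qed.

Lemma super_deg0 b : super_deg deg b 0.
Proof. by exists [::], (fun=> 0); split=> // [n|]; [apply: deg0 | rewrite big_nil]. Qed.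

Lemma super_deg_homogeneous n x : deg n x -> super_deg deg (odd `|n|%N) x.
Proof.
move=> dx; exists [:: n], (fun m => if m == n then x else 0).
split=> [m|m|]; first by rewrite inE => /eqP->.
  by case: eqP => [->|_] //; apply: deg0.
by rewrite big_seq1 eqxx.
Qed.

(** Over a common list of distinct degrees the difference of the two decompositions is a vanishing
    sum, so each of its components is 0. A degree in [s] has parity [b] and does not occur in [s'],
    so its component comes from [s] alone. *)
Lemma super_deg_disjoint b x :
  super_deg deg b x -> super_deg deg (~~ b) x -> x = 0.
Proof.
move=> [s [c [sb dc ->]]] [s' [c' [sb' dc' E]]].
set r := undup (s ++ s').
have sr : {subset s <= r} by move=> n ns; rewrite mem_undup mem_cat ns.
have sr' : {subset s' <= r} by move=> n ns; rewrite mem_undup mem_cat ns orbT.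
have ur : uniq r by apply: undup_uniq.
move: E; rewrite (big_count c ur sr) (big_count c' ur sr') => /eqP.
rewrite -subr_eq0 -sumrB => /eqP E.
case: deg_grading => _ _ _ /(_ r _ ur _ E) c0.
rewrite big_seq big1 // => n nr.
have [ns|ns] := boolP (n \in s); last by rewrite (count_memPn ns).
have := c0 (fun m => degB (degMn _ (dc m)) (degMn _ (dc' m))) n nr.
suff -> : count_mem n s' = 0%N by rewrite subr0.
apply/count_memPn/negP => /sb'; rewrite (sb n ns).
by case: (b).
Qed.

Lemma super_deg_split b x :
  exists y, super_deg deg b y /\ super_deg deg (~~ b) (x - y).
Proof.
case: deg_grading => _ _ /(_ x)[s [c [dc ->]]] _.
exists (\sum_(n <- s | odd `|n|%N == b) c n); split.
  exists [seq n <- s | odd `|n|%N == b], c; split=> [n||]; last by rewrite big_filter.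
    by rewrite mem_filter => /andP[/eqP].
  exact: dc.
exists [seq n <- s | odd `|n|%N != b], c; split=> [n||]; last first.
  by rewrite big_filter (bigID (fun n => odd `|n|%N == b)) /= addrAC subrr add0r.
  exact: dc.
by rewrite mem_filter => /andP[]; case: odd (b) => -[].
Qed.

Lemma super_partP b x :
  super_deg deg b (super_part deg b x) /\
  super_deg deg (~~ b) (x - super_part deg b x).
Proof.
have [y yP] := super_deg_split b x; rewrite /super_part.
by case: xgetP => [z _ [] | /(_ y)/(_ yP)].
Qed.

(** [super_part] is a value picked by choice; uniqueness identifies it and yields its linearity and
    its value on homogeneous elements. *)
Lemma super_part_unique b x y :
  super_deg deg b y -> super_deg deg (~~ b) (x - y) -> super_part deg b x = y.
Proof.
have [zb xzb] := super_partP b x => yb xyb.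
apply/eqP; rewrite -subr_eq0; apply/eqP/(@super_deg_disjoint b).
  by rewrite addrC -scaleN1r; apply: super_degP.
have -> : super_part deg b x - y = -1 *: (x - super_part deg b x) + (x - y).
  by rewrite scaleN1r opprB addrA subrK.
exact: super_degP.
Qed.

Lemma super_part_linear b : linear (super_part deg b).
Proof.
move=> a x y; have [xb xb'] := super_partP b x; have [yb yb'] := super_partP b y.
apply: super_part_unique; first exact: super_degP.
by rewrite opprD addrACA -scalerBr; apply: super_degP.
Qed.

Lemma super_part_homogeneous b n x : deg n x ->
  super_part deg b x = if odd `|n|%N == b then x else 0.
Proof.
move=> /super_deg_homogeneous dx; apply: super_part_unique.
  by case: eqP => [<-|_] //; apply: super_deg0.
case: eqP => [_|]; first by rewrite subrr; apply: super_deg0.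
by rewrite subr0; move: dx; case: odd (b) => -[].
Qed.

Definition parity_op (x : V) : V := super_part deg false x - super_part deg true x.

Lemma parity_op_linear : linear parity_op.
Proof.
by move=> a x y; rewrite /parity_op !super_part_linear opprD addrACA -scalerBr.
Qed.

Lemma parity_op_homogeneous n x : deg n x -> parity_op x = (-1) ^+ `|n|%N *: x.
Proof.
move=> dx; rewrite /parity_op !(super_part_homogeneous _ dx) -signr_odd.
by case: odd; rewrite ?subr0 ?sub0r ?scaleN1r ?scale1r.
Qed.

End Gradings.

(** The proof that [deg] is a grading is an argument so that the operator can carry a canonical
    linear structure, which depends on this proof. *)
Definition parity (k : comNzRingType) (V : lmodType k) (deg : int -> V -> Prop)
  of is_grading deg := parity_op deg.

HB.instance Definition _ (k : comNzRingType) (V : lmodType k)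
    (deg : int -> V -> Prop) (gr : is_grading deg) :=
  GRing.isLinear.Build k V V *:%R (@parity k V deg gr) (parity_op_linear gr).

(** * Powers of the parity operator *)

Section Parity.
Context (k : comNzRingType) (V : lmodType k) (deg : int -> V -> Prop).
Hypothesis gr : is_grading deg.
Local Notation σ := (parity gr).

Lemma iter_parity_linear p : linear (iter p σ).
Proof. by elim: p => [|p IH] a x y //=; rewrite IH linearP. Qed.

HB.instance Definition _ p :=
  GRing.isLinear.Build k V V *:%R (iter p σ) (iter_parity_linear p).

Lemma iter_parity_homogeneous p n x : deg n x ->
  iter p σ x = (-1) ^+ (p * `|n|)%N *: x.
Proof.
move=> dx; elim: p => [|p IH]; first by rewrite scale1r.
by rewrite iterS IH linearZ /= /parity (parity_op_homogeneous gr dx) scalerA -exprD mulSnr.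
Qed.

Lemma deg_iter_parity p n x : deg n x -> deg n (iter p σ x).
Proof. by move=> dx; rewrite (iter_parity_homogeneous p dx); apply: degZ. Qed.

(** σ is an involution, so only the parity of the exponent matters. This reconciles the booleans in
    the braiding with exponents that are degrees. *)
Lemma iter_parity_odd p x : iter (odd p) σ x = iter p σ x.
Proof.
elim/(homogeneous_ind gr): x => [x y IHx IHy|n x dx]; first by rewrite !linearD /= IHx IHy.
by rewrite !(iter_parity_homogeneous _ dx) -signr_odd oddM oddb -oddM signr_odd.
Qed.

(** The right side is the sum over parities that occurs in the braiding, with [odd p] the parity of
    the other factor. *)
Lemma iter_parityE p x :
  iter p σ x = \sum_(b : bool) (-1) ^+ (odd p && b) *: super_part deg b x.
Proof.
elim/(homogeneous_ind gr): x => [x y IHx IHy|n x dx].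
  rewrite linearD /= IHx IHy -big_split; apply: eq_bigr => b _ /=.
  by rewrite -scalerDr !(linear_forE (super_part_linear gr b)).
rewrite (iter_parity_homogeneous _ dx) big_bool /= !(super_part_homogeneous gr _ dx).
rewrite -signr_odd oddM andbT andbF.
by case: (odd `|n|); rewrite /= ?andbT ?andbF ?scaler0 ?addr0 ?add0r.
Qed.

End Parity.

Lemma parity_morph (k : comNzRingType) (V W : lmodType k) degV degW
    (grV : @is_grading k V degV) (grW : @is_grading k W degW) (f : {linear V -> W}) :
  (forall n x, degV n x -> degW n (f x)) ->
  forall p x, f (iter p (parity grV) x) = iter p (parity grW) (f x).
Proof.
move=> df p x; elim/(homogeneous_ind grV): x => [x y IHx IHy|n x dx].
  by rewrite !linearD /= IHx IHy.
by rewrite (iter_parity_homogeneous _ _ (df _ _ dx)) (iter_parity_homogeneous _ _ dx) linearZ.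
Qed.

(** * Left multiplication in the signed product on A ⊗ A *)

Section LeftMultiplication.
Context (k : comNzRingType) (A : algType k) (deg : int -> A -> Prop).
Hypothesis gr : is_grading deg.
Local Notation σ := (parity gr).

(* The twist by σ^p is the sign of moving an element of degree p past the     *)
(* argument: for y of degree p, (x ⊗ y)(a ⊗ b) = x σ^p(a) ⊗ y b.              *)
Definition twisted_mul (p : nat) (x y : A) : A := x * iter p σ y.

Lemma twisted_mul_linear p x : linear (twisted_mul p x).
Proof. by move=> a y z; rewrite /twisted_mul linearP mulrDr scalerAr. Qed.

HB.instance Definition _ p x :=
  GRing.isLinear.Build k A A *:%R (twisted_mul p x) (twisted_mul_linear p x).

Lemma braidingE v w : braiding deg deg (v ⊗ w) =
  \sum_(a : bool) \sum_(b : bool)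
    (-1) ^+ (a && b) *: (super_part deg b w ⊗ super_part deg a v).
Proof.
rewrite /braiding tensor_lift_pure //; have sl := super_part_linear gr.
split=> [y a x x'|x a y y'] /=; rewrite scaler_sumr -big_split; apply: eq_bigr => b _ /=;
  rewrite scaler_sumr -big_split; apply: eq_bigr => c _ /=.
  by rewrite sl pureDr pureZr scalerDr !scalerA mulrC.
by rewrite sl pureDl pureZl scalerDr !scalerA mulrC.
Qed.

Lemma braiding_homogeneous m n v w : deg m v -> deg n w ->
  braiding deg deg (v ⊗ w) = (-1) ^+ `|(m * n)%R|%N *: (w ⊗ v).
Proof.
move=> dv dw; rewrite braidingE !big_bool /= !(super_part_homogeneous gr _ dv).
rewrite !(super_part_homogeneous gr _ dw) -[in RHS]signr_odd abszM oddM.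
case: (odd `|m|); case: (odd `|n|);
  by rewrite /= ?pure0l ?pure0r ?scaler0 ?addr0 ?add0r ?pure0l ?pure0r ?scaler0 ?addr0 ?add0r.
Qed.

(** For a fixed parity a of x2, the sum over the parities of y1 in the braiding is σ^a(y1), by
    [iter_parityE]. *)
Lemma tensor_mul_inner x1 x2 y1 y2 :
  tensor_lift (fun y x => (x1 * y) ⊗ (x * y2)) (braiding deg deg (x2 ⊗ y1)) =
  \sum_(a : bool) (twisted_mul a x1 y1 ⊗ (super_part deg a x2 * y2)).
Proof.
have bl : bilinear_for *:%R *:%R (fun y x => (x1 * y) ⊗ (x * y2)).
  split=> [y a x x'|x a y y'] /=.
    by rewrite mulrDr -scalerAr pureDl pureZl.
  by rewrite mulrDl -scalerAl pureDr pureZr.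
have ll := tensor_lift_linear bl.
rewrite braidingE (linear_for_sum _ _ ll); apply: eq_bigr => a _.
rewrite (linear_for_sum _ _ ll) /twisted_mul iter_parityE mulr_sumr pure_suml.
apply: eq_bigr => b _; rewrite (linear_forE ll) tensor_lift_pure //.
by rewrite -scalerAr pureZl oddb.
Qed.

(** Both sides run over the same formal sum representing [u], so the identity holds term by term. *)
Lemma tensor_mul_outer x1 x2 u :
  tensor_lift (fun y1 y2 =>
    tensor_lift (fun y x => (x1 * y) ⊗ (x * y2)) (braiding deg deg (x2 ⊗ y1))) u =
  \sum_(a : bool) tensor_map (twisted_mul a x1) (twisted_mul 0 (super_part deg a x2)) u.
Proof.
rewrite /tensor_map /tensor_lift /bilin_eval exchange_big; apply: eq_bigr => p _ /=.
exact: tensor_mul_inner.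
Qed.

Lemma tensor_mul_bilinear u :
  bilinear_for *:%R *:%R (fun x1 x2 => tensor_lift (fun y1 y2 =>
    tensor_lift (fun y x => (x1 * y) ⊗ (x * y2)) (braiding deg deg (x2 ⊗ y1))) u).
Proof.
have sl := super_part_linear gr.
split=> [z a x x'|x a z z']; rewrite /= !tensor_mul_outer scaler_sumr -big_split;
  apply: eq_bigr => b _ /=; rewrite /tensor_map /tensor_lift /bilin_eval scaler_sumr;
  rewrite -big_split; apply: eq_bigr => p _ /=.
  by rewrite /twisted_mul mulrDl -scalerAl pureDl pureZl.
by rewrite /twisted_mul sl mulrDl -scalerAl pureDr pureZr.
Qed.

(** For homogeneous x2 one parity part is x2 and the other vanishes, so the product becomes a single
    tensor product of linear maps. *)
Lemma tensor_mulE n x1 x2 u : deg n x2 ->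
  tensor_mul deg (x1 ⊗ x2) u = tensor_map (twisted_mul `|n| x1) (twisted_mul 0 x2) u.
Proof.
move=> dx2; rewrite /tensor_mul tensor_lift_pure ?tensor_mul_outer; last exact: tensor_mul_bilinear.
elim/tensor_ind: u => [a t u IHt IHu|y1 y2].
  rewrite linearP /= -IHt -IHu scaler_sumr -big_split; apply: eq_bigr => b _ /=.
  by rewrite linearP.
rewrite tensor_mapE big_bool /= !tensor_mapE !(super_part_homogeneous gr _ dx2).
rewrite /twisted_mul /= -(iter_parity_odd gr `|n|).
by case: (odd `|n|); rewrite /twisted_mul /= mul0r pure0r ?add0r ?addr0.
Qed.

Lemma tensor_mul_linearl u : linear (tensor_mul deg ^~ u).
Proof. exact/tensor_lift_linear/tensor_mul_bilinear. Qed.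

End LeftMultiplication.

(** * Triangular double sums and parities of degrees *)

Lemma eq_tensor_map (k : comNzRingType) (M N M' N' : lmodType k)
    (f f' : M -> M') (g g' : N -> N') :
  f =1 f' -> g =1 g' -> tensor_map f g =1 tensor_map f' g'.
Proof. by move=> ff gg t; apply: eq_bigr => p _; rewrite ff gg. Qed.

(** The pairs j <= m <= n are reindexed by m = j + l. This serves both coassociativity and the
    associativity of convolution. *)
Lemma big_triangle (V : nmodType) n (G : nat -> nat -> V) :
  \sum_(m < n.+1) \sum_(j < m.+1) G j m =
  \sum_(j < n.+1) \sum_(l < (n - j).+1) G j (j + l)%N.
Proof.
transitivity (\sum_(0 <= m < n.+1) \sum_(0 <= j < n.+1 | (j <= m)%N) G j m).
  rewrite big_mkord; apply: eq_bigr => m _.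
  by rewrite -(big_mkord xpredT (G ^~ m)) (big_nat_widen _ _ n.+1) //.
rewrite (exchange_big_dep_nat xpredT) //= big_mkord; apply: eq_bigr => j _.
rewrite big_mkord -(big_geq_mkord _ _ xpredT (G j)) -{1}[nat_of_ord j]add0n big_addn.
rewrite (subSn (ltn_ord j : (j <= n)%N)) big_mkord.
by apply: eq_bigr => l _; rewrite addnC.
Qed.

(** Degrees are integers, and the absolute value is not additive, but its parity is. *)
Lemma odd_absD (m n : int) : odd `|(m + n)%R|%N = odd `|m| (+) odd `|n|.
Proof.
have odd_dist (a b : nat) : odd `|(a%:Z - b%:Z)%R|%N = odd a (+) odd b.
  case: (leqP a b) => [|/ltnW] ab; last by rewrite distnEl // oddB.
  by rewrite distnEr // oddB // addbC.
case: m n => m [] n; rewrite ?NegzE ?abszN ?odd_dist //; first exact: oddD.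
  by rewrite addrC odd_dist addbC.
by rewrite -opprD abszN; apply: oddD.
Qed.

(** * Parity and homogeneous tensors in a graded algebra *)

Section GradedAlgebra.
Context (k : comNzRingType) (A : algType k) (deg : int -> A -> Prop).
Hypothesis gr : is_grading deg.
Hypothesis deg1 : deg 0 1.
Hypothesis degM : forall m n x y, deg m x -> deg n y -> deg (m + n) (x * y).
Local Notation σ := (parity gr).
Local Notation tm := (twisted_mul gr).

Lemma tensor_homogeneous_ind (T : A ⊗ A -> Prop) :
  (forall t u, T t -> T u -> T (t + u)) ->
  (forall i j x y, deg i x -> deg j y -> T (x ⊗ y)) -> forall t, T t.
Proof.
move=> TD Tpure t; rewrite (tensor_pure_sum t).
apply: big_ind => // [|[x y] _ /=].
  by rewrite -(pure0l A (0 : A)); apply: (Tpure 0 0); apply: deg0.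
elim/(homogeneous_ind gr): x => [x x' Tx Tx'|i x dx]; first by rewrite pureDl; apply: TD.
elim/(homogeneous_ind gr): y => [y y' Ty Ty'|j y dy]; first by rewrite pureDr; apply: TD.
exact: Tpure dx dy.
Qed.

Lemma iter_parityM p x y : iter p σ (x * y) = iter p σ x * iter p σ y.
Proof.
elim/(homogeneous_ind gr): x => [x x' IHx IHx'|i x dx].
  by rewrite mulrDl !linearD /= mulrDl IHx IHx'.
elim/(homogeneous_ind gr): y => [y y' IHy IHy'|j y dy].
  by rewrite mulrDr !linearD /= mulrDr IHy IHy'.
rewrite (iter_parity_homogeneous gr _ dx) (iter_parity_homogeneous gr _ dy).
rewrite (iter_parity_homogeneous gr _ (degM dx dy)) -scalerAl -scalerAr scalerA -exprD.
by rewrite -signr_odd oddM odd_absD -mulnDr -[in RHS]signr_odd oddM oddD.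
Qed.

(** σ^p is multiplicative, so the twists add and the outer one also acts on [y]. *)
Lemma twisted_mul_comp p q x y z : tm p x (tm q y z) = tm (p + q) (x * iter p σ y) z.
Proof. by rewrite /twisted_mul iter_parityM mulrA iterD. Qed.

Lemma tensor_deg_lin n a t u : tensor_deg deg deg n t -> tensor_deg deg deg n u ->
  tensor_deg deg deg n (a *: t + u).
Proof.
move=> [s sd ->] [r rd ->]; exists ([seq (a *: p.1, p.2) | p <- s] ++ r).
  move=> p; rewrite mem_cat => /orP[/mapP[q /sd[i [j [ij d1 d2]]] ->]|/rd//].
  by exists i, j; split=> //; apply: degZ.
rewrite big_cat big_map scaler_sumr; congr (_ + _).
by apply: eq_bigr => p _; rewrite pureZl.
Qed.

Lemma tensor_deg_pure i j x y : deg i x -> deg j y ->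
  tensor_deg deg deg (i + j) (x ⊗ y).
Proof.
move=> dx dy; exists [:: (x, y)]; last by rewrite big_seq1.
by move=> p; rewrite inE => /eqP ->; exists i, j.
Qed.

Lemma tensor_deg_sum n (I : eqType) (s : seq I) (F : I -> A ⊗ A) :
  (forall i, i \in s -> tensor_deg deg deg n (F i)) ->
  tensor_deg deg deg n (\sum_(i <- s) F i).
Proof.
move=> dF; rewrite big_seq; apply: big_ind => // [|t u dt du].
  by exists [::]; rewrite ?big_nil.
by rewrite -[t]scale1r; apply: tensor_deg_lin.
Qed.

Lemma tensor_map_parity p n t : tensor_deg deg deg n t ->
  tensor_map (iter p σ) (iter p σ) t = (-1) ^+ (p * `|n|)%N *: t.
Proof.
move=> [s sd ->]; rewrite linear_sum scaler_sumr /=; apply: eq_big_seq => q /sd.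
move=> [i [j [<- dx dy]]]; rewrite tensor_mapE /=.
rewrite (iter_parity_homogeneous gr _ dx) (iter_parity_homogeneous gr _ dy).
rewrite pureZl pureZr scalerA -exprD -mulnDr -[in LHS]signr_odd -[in RHS]signr_odd.
by rewrite !oddM oddD odd_absD.
Qed.

Lemma tensor_mul1 u : tensor_mul deg (1 ⊗ 1) u = u.
Proof.
rewrite (tensor_mulE gr _ _ deg1); elim/tensor_ind: u => [a t u IHt IHu|x y].
  by rewrite linearP /= IHt IHu.
by rewrite tensor_mapE /= /twisted_mul /= !mul1r.
Qed.

End GradedAlgebra.

(** * Reduction of the Hopf axioms to generators *)

Section GradedHopf.
Context (k : comNzRingType) (A : algType k) (deg : int -> A -> Prop).
Hypothesis gr : is_grading deg.
Hypothesis deg1 : deg 0 1.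
Hypothesis degM : forall m n x y, deg m x -> deg n y -> deg (m + n) (x * y).
Local Notation σ := (parity gr).
Local Notation tm := (twisted_mul gr).

Variable h : nat -> A.
Hypothesis h0 : h 0%N = 1.
Hypothesis deg_h : forall n, deg n%:Z (h n).
Hypothesis span_words : forall n (T : A -> Prop),
  T 0 -> (forall a x y, T x -> T y -> T (a *: x + y)) ->
  (forall al, (sumn al)%:Z = n -> T (comp_prod h al)) -> forall x, deg n x -> T x.

Lemma comp_prod_cons n al : comp_prod h (n :: al) = h n * comp_prod h al.
Proof. by rewrite /comp_prod big_cons. Qed.

Lemma deg_word al : deg (sumn al)%:Z (comp_prod h al).
Proof.
elim: al => [|n al IH]; first by rewrite /comp_prod big_nil.
by rewrite comp_prod_cons /= PoszD; apply: degM.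
Qed.

(** The degree of the tail is kept because [Delta_antipoder] has to replace σ^p(x) by a sign times
    x. *)
Lemma word_ind (T : A -> Prop) :
  (forall a x y, T x -> T y -> T (a *: x + y)) -> T 1 ->
  (forall n m x, (0 < n)%N -> deg m x -> T x -> T (h n * x)) -> forall x, T x.
Proof.
move=> Tlin T1 Th x; elim/(homogeneous_ind gr): x => [x y Tx Ty|n x].
  by rewrite -[x]scale1r; apply: Tlin.
(* Zero is obtained from 1 as -1 *: 1 + 1. *)
apply: span_words => //; first by rewrite -(addNr 1) -scaleN1r; apply: Tlin.
move=> al _; elim: al => [|[|m] al IH].
- by rewrite /comp_prod big_nil.
(* A letter 0 is the factor h_0 = 1 and drops out. *)
- by rewrite comp_prod_cons h0 mul1r.
by rewrite comp_prod_cons; apply: Th IH => //; apply: deg_word.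
Qed.

(* Left multiplication by Δ(h_n).                                             *)
Definition Delta_h_mul (n : nat) (t : A ⊗ A) : A ⊗ A :=
  \sum_(m < n.+1) tensor_map (tm (n - m)%N (h m)) (tm 0 (h (n - m)%N)) t.

Lemma Delta_h_mul_linear n : linear (Delta_h_mul n).
Proof.
move=> a t u; rewrite /Delta_h_mul scaler_sumr -big_split; apply: eq_bigr => m _.
by rewrite linearP.
Qed.

HB.instance Definition _ n :=
  GRing.isLinear.Build k (A ⊗ A)%type (A ⊗ A)%type *:%R (Delta_h_mul n) (Delta_h_mul_linear n).

Variable Delta : {linear A -> (A ⊗ A)%type}.
Hypothesis Delta1 : Delta 1 = 1 ⊗ 1.
Hypothesis Delta_h : forall n x, (0 < n)%N -> Delta (h n * x) = Delta_h_mul n (Delta x).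

Lemma Delta_hE n x : Delta (h n * x) = Delta_h_mul n (Delta x).
Proof.
case: n => [|n]; last exact: Delta_h.
rewrite h0 mul1r /Delta_h_mul big_ord1 h0.
elim/tensor_ind: (Delta x) => [a t u IHt IHu|y z].
  by rewrite linearP /= -IHt -IHu.
by rewrite tensor_mapE /= /twisted_mul /= !mul1r.
Qed.

Lemma deg_Delta_h_mul n m t : tensor_deg deg deg m t ->
  tensor_deg deg deg (n%:Z + m) (Delta_h_mul n t).
Proof.
move=> [s sd ->]; rewrite linear_sum; apply: (tensor_deg_sum gr) => p /sd.
move=> [i [j [<- dx dy]]]; apply: (tensor_deg_sum gr) => q _.
have -> : n%:Z + (i + j) = q%:Z + i + ((n - q)%:Z + j).
  by rewrite addrACA -PoszD subnKC // -ltnS.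
rewrite tensor_mapE; apply: tensor_deg_pure; apply: degM => //.
exact: deg_iter_parity.
Qed.

Lemma deg_Delta n x : deg n x -> tensor_deg deg deg n (Delta x).
Proof.
move: x; apply: (@span_words n (fun x => _ (Delta x))) => [|a y z dy dz|al <- {n}].
  - by rewrite linear0; exists [::]; rewrite ?big_nil.
  - by rewrite linearP; apply: tensor_deg_lin.
elim: al => [|n al IH].
  by rewrite /comp_prod big_nil Delta1 -[0%:Z]addr0; apply: tensor_deg_pure.
by rewrite comp_prod_cons Delta_hE /= PoszD; apply: deg_Delta_h_mul.
Qed.

Lemma Delta_parity p x :
  Delta (iter p σ x) = tensor_map (iter p σ) (iter p σ) (Delta x).
Proof.
elim/(homogeneous_ind gr): x => [x y IHx IHy|n x dx].
  by rewrite !linearD /= IHx IHy.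
by rewrite (iter_parity_homogeneous gr _ dx) linearZ (tensor_map_parity gr _ (deg_Delta dx)).
Qed.

(** Δ commutes with σ^p, so in Δ(h_m σ^p(x)) the twist by p acts on both tensor factors of Δ(x). The
    first factor also carries the twist m - j coming from Δ(h_m). *)
Lemma Delta_id_h_mul m p q t :
  tensor_map Delta idfun (tensor_map (tm p (h m)) (tm 0 (h q)) t) =
  \sum_(j < m.+1) tensor_map (tensor_map (tm (m - j + p) (h j)) (tm p (h (m - j)%N)))
    (tm 0 (h q)) (tensor_map Delta idfun t).
Proof.
elim/tensor_ind: t => [a t u IHt IHu|x y].
  rewrite !linearP /= IHt IHu scaler_sumr -big_split; apply: eq_bigr => j _ /=.
  by rewrite linearP.
rewrite !tensor_mapE /= {1}/twisted_mul Delta_hE Delta_parity pure_suml.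
apply: eq_bigr => j _; rewrite tensor_mapE tensor_map_comp; congr (_ ⊗ _).
by apply: eq_tensor_map => z /=; rewrite /twisted_mul ?iterD.
Qed.

Lemma id_Delta_h_mul m p q t :
  tensor_map idfun Delta (tensor_map (tm p (h m)) (tm 0 (h q)) t) =
  \sum_(l < q.+1) tensor_map (tm p (h m))
    (tensor_map (tm (q - l)%N (h l)) (tm 0 (h (q - l)%N))) (tensor_map idfun Delta t).
Proof.
elim/tensor_ind: t => [a t u IHt IHu|x y].
  rewrite !linearP /= IHt IHu scaler_sumr -big_split; apply: eq_bigr => j _ /=.
  by rewrite linearP.
rewrite !tensor_mapE /= {2}/twisted_mul Delta_hE pure_sumr.
by apply: eq_bigr => j _; rewrite tensor_mapE.
Qed.

Lemma Delta_coassoc x :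
  tensor_assoc (tensor_map Delta id (Delta x)) = tensor_map id Delta (Delta x).
Proof.
rewrite -[id]/idfun; elim/word_ind: x => [a x y IHx IHy||n m x n_gt0 _ IHx].
- by rewrite !linearP /= IHx IHy.
- by rewrite Delta1 !tensor_mapE /= Delta1 tensor_assocE.
rewrite Delta_h // /Delta_h_mul [tensor_map Delta _ _]linear_sum /= linear_sum /=.
rewrite [in RHS]linear_sum /=.
under eq_bigr => i _.
  rewrite Delta_id_h_mul linear_sum /=.
  under eq_bigr => j _ do rewrite tensor_assoc_map IHx.
  over.
under [RHS]eq_bigr => i _ do rewrite id_Delta_h_mul.
(* Common form of the terms on both sides: [G j l] multiplies by h_j ⊗ h_(l-j) ⊗ h_(n-l), each
   factor twisted by the total weight of the factors to its right. The left side sums over l first,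
   the right side over j first. *)
pose G j l : A ⊗ (A ⊗ A) := tensor_map (tm (n - j)%N (h j))
  (tensor_map (tm (n - l)%N (h (l - j)%N)) (tm 0 (h (n - l)%N)))
  (tensor_map idfun Delta (Delta x)).
transitivity (\sum_(i < n.+1) \sum_(j < i.+1) G j i).
  apply: eq_bigr => i _; apply: eq_bigr => j _; rewrite /G.
  have ij : (j <= i)%N := ltn_ord j; have jn : (i <= n)%N := ltn_ord i.
  by rewrite addnC addnBA // subnK.
rewrite big_triangle; apply: eq_bigr => i _; apply: eq_bigr => j _.
by rewrite /G subnDA addKn.
Qed.

Variable eps : {scalar A}.
Hypothesis eps1 : eps 1 = 1.
Hypothesis deg_eps : forall n x, deg n x -> n != 0 -> eps x = 0.

Lemma eps_parity p x : eps (iter p σ x) = eps x.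
Proof.
elim/(homogeneous_ind gr): x => [x y IHx IHy|n x dx]; first by rewrite !linearD /= IHx IHy.
rewrite (iter_parity_homogeneous gr _ dx) linearZ /=.
have [->|n0] := eqVneq n 0; first by rewrite muln0 mul1r.
by rewrite (deg_eps dx n0) mulr0.
Qed.

(** Words have nonnegative weight, so h_n times a word has positive degree. Passing to words rules
    out components of negative degree, which could cancel the degree of h_n. *)
Lemma eps_h n x : (0 < n)%N -> eps (h n * x) = 0.
Proof.
move=> n_gt0; elim/(homogeneous_ind gr): x => [x y IHx IHy|m x].
  by rewrite mulrDr linearD /= IHx IHy addr0.
move: x; apply: span_words => [|a x y IHx IHy|al _]; first by rewrite mulr0 linear0.
  by rewrite mulrDr -scalerAr linearP IHx IHy /= mulr0 addr0.
apply: deg_eps (degM (deg_h n) (deg_word al)) _.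
by rewrite -PoszD eqz_nat addn_eq0 negb_and -lt0n n_gt0.
Qed.

Lemma epsM x y : eps (x * y) = eps x * eps y.
Proof.
elim/word_ind: x => [a x z IHx IHz||n m x n_gt0 _ IHx].
- by rewrite mulrDl -scalerAl !linearP /= IHx IHz mulrDl mulrA.
- by rewrite mul1r eps1 mul1r.
by rewrite -mulrA !eps_h // mul0r.
Qed.

(** Of Δ(h_n) only the term m = 0 survives [eps], and its twist σ^n is invisible to [eps]. *)
Lemma Delta_counitl x : tensor_lift (fun a b => eps a *: b) (Delta x) = x.
Proof.
have bl : bilinear_for *:%R *:%R (fun a b : A => eps a *: b).
  split=> [y a z z'|z a y y'] /=; first by rewrite linearP scalerDl scalerA.
  by rewrite scalerDr !scalerA mulrC.
have ll := tensor_lift_linear bl.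
elim/word_ind: x => [a x y IHx IHy||n m x n_gt0 _ IHx].
- by rewrite linearP ll IHx IHy.
- by rewrite Delta1 tensor_lift_pure // eps1 scale1r.
rewrite Delta_h // -[in RHS]IHx; elim/tensor_ind: (Delta x) => [a t u IHt IHu|y z].
  by rewrite linearP !ll mulrDr -scalerAr IHt IHu.
rewrite /Delta_h_mul (linear_for_sum _ _ ll) big_ord_recl big1 ?addr0 => [|i _].
  rewrite tensor_mapE !tensor_lift_pure //= /twisted_mul h0 mul1r eps_parity.
  by rewrite subn0 scalerAr.
by rewrite tensor_mapE tensor_lift_pure //= /twisted_mul eps_h // scale0r.
Qed.

(** Here only the term m = n survives, where the twist is trivial. *)
Lemma Delta_counitr x : tensor_lift (fun a b => eps b *: a) (Delta x) = x.
Proof.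
have bl : bilinear_for *:%R *:%R (fun a b : A => eps b *: a).
  split=> [y a z z'|z a y y'] /=; last by rewrite linearP scalerDl scalerA.
  by rewrite scalerDr !scalerA mulrC.
have ll := tensor_lift_linear bl.
elim/word_ind: x => [a x y IHx IHy||n m x n_gt0 _ IHx].
- by rewrite linearP ll IHx IHy.
- by rewrite Delta1 tensor_lift_pure // eps1 scale1r.
rewrite Delta_h // -[in RHS]IHx; elim/tensor_ind: (Delta x) => [a t u IHt IHu|y z].
  by rewrite linearP !ll mulrDr -scalerAr IHt IHu.
rewrite /Delta_h_mul (linear_for_sum _ _ ll) big_ord_recr big1 ?add0r => [|i _].
  rewrite tensor_mapE !tensor_lift_pure //= /twisted_mul subnn h0 mul1r.
  by rewrite add0r scalerAr.
by rewrite tensor_mapE tensor_lift_pure //= /twisted_mul eps_h ?scale0r // subn_gt0.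
Qed.

Lemma tensor_mul_sum (I : Type) (s : seq I) (F : I -> A ⊗ A) u :
  tensor_mul deg (\sum_(i <- s) F i) u = \sum_(i <- s) tensor_mul deg (F i) u.
Proof. exact: (linear_for_sum _ _ (tensor_mul_linearl gr u)). Qed.

Lemma Delta_h_mulA n t u :
  Delta_h_mul n (tensor_mul deg t u) = tensor_mul deg (Delta_h_mul n t) u.
Proof.
have ll := tensor_mul_linearl gr u.
elim/(tensor_homogeneous_ind gr): t => [t t' IHt IHt'|i j x y dx dy].
  by rewrite (linear_forE ll) !linearD /= (linear_forE ll) IHt IHt'.
rewrite (tensor_mulE gr _ _ dy) /Delta_h_mul tensor_mul_sum; apply: eq_bigr => m _.
rewrite tensor_mapE (tensor_mulE gr _ _ (degM (deg_h _) dy)) tensor_map_comp.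
apply: eq_tensor_map => z /=; rewrite (twisted_mul_comp gr degM) /=; last by [].
(* The two twists are (n - m) + |j| and |(n - m) + j|, which have the same parity. *)
rewrite /twisted_mul -(iter_parity_odd gr `|_|) odd_absD /=.
by rewrite -(iter_parity_odd gr (_ + _)) oddD.
Qed.

Lemma DeltaM x y : Delta (x * y) = tensor_mul deg (Delta x) (Delta y).
Proof.
elim/word_ind: x => [a x z IHx IHz||n m x n_gt0 _ IHx].
- by rewrite mulrDl -scalerAl !linearP /= tensor_mul_linearl // IHx IHz.
- by rewrite mul1r Delta1 tensor_mul1.
by rewrite -mulrA !Delta_h // IHx Delta_h_mulA.
Qed.

Variable S : {linear A -> A}.
Hypothesis S1 : S 1 = 1.
Hypothesis S_antih : forall n x, S (h n * x) = S (iter n σ x) * S (h n).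
Hypothesis deg_S : forall n x, deg n x -> deg n (S x).
Hypothesis S_mulh : forall n, (0 < n)%N -> \sum_(m < n.+1) S (h m) * h (n - m)%N = 0.
Hypothesis h_mulS : forall n, (0 < n)%N -> \sum_(m < n.+1) h m * S (h (n - m)%N) = 0.

Lemma convolution_bilinear (f g : {linear A -> A}) :
  bilinear_for *:%R *:%R (fun a b => f a * g b).
Proof.
by split=> [y a x x'|x a y y'] /=; rewrite linearP ?mulrDl ?mulrDr -?scalerAl -?scalerAr.
Qed.

(** S(h_m σ^(n-m)(y)) = S(σ^n(y)) S(h_m) has the same left factor for every m. Hence the sum over m
    has Σ S(h_m) h_(n-m) = 0 in its middle, whatever y and z are. *)
Lemma Delta_antipodel x : tensor_lift (fun a b => S a * b) (Delta x) = (eps x)%:A.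
Proof.
have bl := convolution_bilinear S idfun; have ll := tensor_lift_linear bl.
elim/word_ind: x => [a x y IHx IHy||n m x n_gt0 _ _].
- by rewrite linearP ll IHx IHy linearP /= scalerDl scalerA.
- by rewrite Delta1 tensor_lift_pure // S1 eps1 scale1r mulr1.
rewrite eps_h // scale0r Delta_h //.
elim/tensor_ind: (Delta x) => [a t u IHt IHu|y z].
  by rewrite linearP ll IHt IHu scaler0 addr0.
rewrite /Delta_h_mul (linear_for_sum _ _ ll).
transitivity (S (iter n σ y) * (\sum_(m < n.+1) S (h m) * h (n - m)%N) * z).
  rewrite mulr_sumr mulr_suml; apply: eq_bigr => i _.
  rewrite tensor_mapE tensor_lift_pure //= /twisted_mul S_antih -iterD /= !mulrA.
  by rewrite subnKC // -ltnS.
by rewrite S_mulh // mulr0 mul0r.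
Qed.

Lemma Delta_antipoder x : tensor_lift (fun a b => a * S b) (Delta x) = (eps x)%:A.
Proof.
have bl := convolution_bilinear idfun S; have ll := tensor_lift_linear bl.
elim/word_ind: x => [a x y IHx IHy||n m x n_gt0 dx IHx].
- by rewrite linearP ll IHx IHy linearP /= scalerDl scalerA.
- by rewrite Delta1 tensor_lift_pure // S1 eps1 scale1r mulr1.
rewrite eps_h // scale0r Delta_h //.
(* Since S(h_p z) = S(σ^p(z)) S(h_p), the twist σ^p reaches both factors. By [Delta_parity] the
   middle is then the convolution evaluated on Δ(σ^p(x)), to which the induction hypothesis
   applies. *)
have E p q t : tensor_lift (fun a b => a * S b) (tensor_map (tm p (h q)) (tm 0 (h p)) t) =
    h q * tensor_lift (fun a b => a * S b) (tensor_map (iter p σ) (iter p σ) t) * S (h p).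
  elim/tensor_ind: t => [a t u IHt IHu|y z].
    by rewrite !linearP !ll IHt IHu mulrDr mulrDl -scalerAr -scalerAl.
  by rewrite !tensor_mapE !tensor_lift_pure //= /twisted_mul S_antih !mulrA.
rewrite /Delta_h_mul (linear_for_sum _ _ ll).
transitivity (eps x *: \sum_(m < n.+1) h m * S (h (n - m)%N)); last first.
  by rewrite h_mulS // scaler0.
rewrite scaler_sumr; apply: eq_bigr => i _; rewrite E -Delta_parity.
rewrite (iter_parity_homogeneous gr _ dx) linearZ (linear_forE ll) IHx /=.
(* The sign left over from σ^p is 1 when x has degree 0; in every other degree [eps x] vanishes. *)
have [->|m0] := eqVneq m 0; first by rewrite muln0 scale1r -scalerAr mulr1 scalerAl.
by rewrite (deg_eps dx m0) scale0r scaler0 mulr0 mul0r scale0r.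
Qed.

Lemma graded_Hopf_of_generators : graded_Hopf_superalgebra deg Delta eps S.
Proof.
split=> //; try exact: linearP.
- by move=> m n v w; apply: braiding_homogeneous.
- exact: deg_Delta.
- exact: Delta_coassoc.
- exact: Delta_counitl.
- exact: Delta_counitr.
- exact: DeltaM.
- exact: epsM.
- exact: Delta_antipodel.
- exact: Delta_antipoder.
Qed.

End GradedHopf.

(** * The free algebra: linear extension from words and the grading *)

Section FreeAlgebraGrading.
Context (k : comNzRingType).
Local Notation Λ' := (Lambda' k).
Implicit Types (x y : Λ') (w : {fmonom nat}).

Definition word_weight w : int := (sumn (composition_of w))%:Z.

Definition word_sum (V : lmodType k) (F : {fmonom nat} -> V) (x : Λ') : V :=
  \sum_(w <- msupp x) x@_w *: F w.

Lemma word_sumEw (V : lmodType k) (F : {fmonom nat} -> V) (x : Λ') (d : {fset {fmonom nat}}) :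
  (msupp x `<=` d)%fset -> word_sum F x = \sum_(w <- d) x@_w *: F w.
Proof.
move=> le; rewrite /word_sum (big_fset_incl _ le) => //= w _ /mcoeff_outdom ->.
by rewrite scale0r.
Qed.

Lemma word_sum_linear (V : lmodType k) (F : {fmonom nat} -> V) : linear (word_sum F).
Proof.
move=> a x y; pose d := (msupp x `|` msupp y)%fset.
have dx : (msupp x `<=` d)%fset by apply: fsubsetUl.
have dy : (msupp y `<=` d)%fset by apply: fsubsetUr.
have dxy : (msupp (a *: x + y) `<=` d)%fset.
  apply: fsubset_trans (msuppD_le _ _) _; rewrite fsubUset dy andbT.
  exact: fsubset_trans (msuppZ_le _ _) dx.
rewrite !(word_sumEw _ dx, word_sumEw _ dy, word_sumEw _ dxy) scaler_sumr -big_split.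
by apply: eq_bigr => w _; rewrite /= mcoeffD mcoeffZ scalerDl scalerA.
Qed.

Lemma word_sumU (V : lmodType k) (F : {fmonom nat} -> V) w :
  word_sum F (<< w >> : Λ') = F w.
Proof.
by rewrite (word_sumEw _ msuppU_le) big_seq_fset1 mcoeffUU scale1r.
Qed.

Lemma word_sum_id x : x = word_sum (fun w => << w >> : Λ') x.
Proof.
rewrite [x in LHS]monalgE; apply: eq_bigr => w _; apply/malgP => u.
by rewrite mcoeffZ !mcoeffU mulrnAr mulr1.
Qed.

Lemma malg_supp_ind (T : Λ' -> Prop) : T 0 ->
  (forall a x y, T x -> T y -> T (a *: x + y)) ->
  forall x, (forall w, w \in msupp x -> T << w >>) -> T x.
Proof.
move=> T0 Tlin x Tw; rewrite (word_sum_id x) /word_sum big_seq.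
apply: (big_ind T) => // [y z Ty Tz|w /Tw Tww]; first by rewrite -[y]scale1r; apply: Tlin.
by rewrite -[_ *: _]addr0; apply: Tlin.
Qed.

Lemma malg_word_ind (T : Λ' -> Prop) : T 0 ->
  (forall a x y, T x -> T y -> T (a *: x + y)) ->
  (forall w, T << w >>) -> forall x, T x.
Proof. by move=> T0 Tlin Tw x; apply: malg_supp_ind => // w _. Qed.

Lemma malg_linear_ext (V : lmodType k) (f g : Λ' -> V) :
  linear f -> linear g -> (forall w, f << w >> = g << w >>) -> f =1 g.
Proof.
move=> lf lg fg; elim/malg_word_ind => [|a x y IHx IHy|w]; last exact: fg.
  by rewrite (linear_forE lf) (linear_forE lg).
by rewrite lf lg IHx IHy.
Qed.

(** Commutativity of [k] turns the left algebra [Lambda'] into an algebra, so that the results on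
    signed products apply to it. *)
Lemma malg_scalerAr a x y : a *: (x * y) = x * (a *: y).
Proof.
rewrite (malgMEw (fsubset_refl (msupp x)) (fsubset_refl (msupp y))).
rewrite (malgMEw (fsubset_refl (msupp x)) (msuppZ_le a y)).
rewrite scaler_sumr; apply: eq_bigr => u _; rewrite scaler_sumr; apply: eq_bigr => v _.
apply/malgP => w; rewrite !mcoeffZ !mcoeffU mulrnAr; congr (_ *+ _).
by rewrite mulrCA.
Qed.

HB.instance Definition _ := GRing.Lalgebra_isAlgebra.Build k (Lambda' k) malg_scalerAr.

Lemma deg'P n x : deg' n x <-> forall w, word_weight w != n -> x@_w = 0.
Proof.
split=> [dx w|dx w]; last by rewrite -mcoeff_neq0; apply: contra_neq_eq => /dx ->.
by apply: contraNeq; rewrite mcoeff_neq0 => /dx <-.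
Qed.

Lemma deg'_word w : deg' (word_weight w) (<< w >> : Λ').
Proof.
apply/deg'P => u; rewrite mcoeffU; case: (eqVneq w u) => [->|_ _] //.
by rewrite eqxx.
Qed.

Lemma deg'_grading : is_grading (@deg' k).
Proof.
have lin n a x y : deg' n x -> deg' n y -> deg' n (a *: x + y).
  move=> /deg'P dx /deg'P dy; apply/deg'P => w wn.
  by rewrite mcoeffD mcoeffZ dx // dy // mulr0 addr0.
have d0 n : deg' n (0 : Λ') by apply/deg'P => w _; rewrite mcoeff0.
split=> // [x|s c us dc sc0 n ns].
  (* The components collect the words of equal weight; the index list consists of the weights that
     occur. *)
  pose s := undup [seq word_weight w | w <- msupp x].
  exists s, (fun n => \sum_(w <- msupp x)
    (if word_weight w == n then x@_w else 0) *: (<< w >> : Λ')).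
  split=> [n|].
    apply: big_ind => // [y z dy dz|w _]; first by rewrite -[y]scale1r; apply: lin.
    case: eqP => [<-|_]; last by rewrite scale0r.
    by rewrite -[_ *: _]addr0; apply: lin => //; apply: deg'_word.
  rewrite exchange_big /= [LHS]word_sum_id /word_sum.
  rewrite [LHS]big_seq [RHS]big_seq; apply: eq_bigr => w wx.
  rewrite (bigD1_seq (word_weight w)) ?undup_uniq //= ?mem_undup ?map_f //.
  rewrite eqxx big1 ?addr0 // => n /negPf nw.
  by rewrite eq_sym nw scale0r.
(* At a word of weight n the coefficient of the vanishing sum is the coefficient of [c n]. *)
apply/malgP => w; rewrite mcoeff0; have [wn|wn] := eqVneq (word_weight w) n.
  rewrite -[RHS](mcoeff0 w) -sc0 raddf_sum (bigD1_seq n) //= big1 ?addr0 // => m mn.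
  by have /deg'P -> := dc m; rewrite // wn eq_sym.
by have /deg'P -> := dc n.
Qed.

End FreeAlgebraGrading.

(** * Products of words, comultiplication and form on the free algebra *)

Section FreeAlgebraWords.
Context (k : comNzRingType).
Local Notation Λ' := (Lambda' k).
Implicit Types (x y : Λ') (w : {fmonom nat}).

Lemma malg_wordM (u v : {fmonom nat}) : (<< u >> : Λ') * << v >> = << mmul u v >>.
Proof. by rewrite [LHS]malgM_def fgmulUU mulr1. Qed.

Lemma word_weightM (u v : {fmonom nat}) :
  word_weight (mmul u v) = word_weight u + word_weight v.
Proof. by rewrite /word_weight /composition_of fmM map_cat sumn_cat PoszD. Qed.

Lemma deg'M m n x y : deg' m x -> deg' n y -> deg' (m + n) (x * y).
Proof.
have gr := deg'_grading k; move=> dx dy.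
apply: (malg_supp_ind (T := fun z => deg' (m + n) (z * y))) => [|a z z' IHz IHz'|u /dx <-].
- by rewrite mul0r; apply: (deg0 gr).
- rewrite mulrDl.
  rewrite -scalerAl.
  exact: (degP gr a IHz IHz').
apply: (malg_supp_ind (T := fun z => deg' (_ + n) (_ * z))) => [|a z z' IHz IHz'|v /dy <-].
- by rewrite mulr0; apply: (deg0 gr).
- rewrite mulrDr -malg_scalerAr.
  exact: (degP gr a IHz IHz').
by rewrite malg_wordM -word_weightM; apply: deg'_word.
Qed.

Lemma malg1E : 1 = << mone >> :> Λ'.
Proof. by []. Qed.

Lemma word_weight1 : word_weight mone = 0.
Proof. by rewrite /word_weight /composition_of fm1. Qed.

Lemma deg'1 : deg' 0 (1 : Λ').
Proof. by rewrite malg1E -word_weight1; apply: deg'_word. Qed.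

Lemma deg'_h n : deg' n%:Z (h' n : Λ').
Proof.
case: n => [|n]; first exact: deg'1.
have := @deg'_word k (fmu n); rewrite /word_weight /composition_of fmU /= addn0.
exact.
Qed.

Lemma h'_word i w : h' i.+1 * (<< w >> : Λ') = << mmul (fmu i) w >>.
Proof. exact: malg_wordM. Qed.

Lemma word_comp_prod w : (<< w >> : Λ') = comp_prod h' (composition_of w).
Proof.
rewrite -[w]fmK /=; elim: (val w) => [|i s IH].
  by rewrite /comp_prod big_nil -fmoneE.
have E : FMonom (i :: s) = mmul (fmu i) (FMonom s) by rewrite [RHS]fmmulE fmuE.
by rewrite [in LHS]E -h'_word IH /comp_prod /composition_of /= big_cons.
Qed.

Lemma Delta'_linear : linear (@Delta' k).
Proof. exact: word_sum_linear. Qed.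

Lemma Delta'_word w : Delta' (<< w >> : Λ') =
  foldr (fun n t => tensor_mul (@deg' k) (Delta'_gen k n) t) (1 ⊗ 1) (composition_of w).
Proof. exact: word_sumU. Qed.

Lemma formE x y : Defs.form x y = word_sum (fun u =>
  word_sum (fun v => form_h k (composition_of u) (composition_of v) : k^o) y) x.
Proof.
apply: eq_bigr => u _; rewrite scaler_sumr; apply: eq_bigr => v _.
by rewrite scalerA.
Qed.

Lemma form_word (u v : {fmonom nat}) :
  Defs.form (<< u >> : Λ') << v >> = form_h k (composition_of u) (composition_of v).
Proof. by rewrite formE !word_sumU. Qed.

Lemma form_linearl y : linear ((@Defs.form k) ^~ y : Λ' -> k^o).
Proof. by move=> a x x'; rewrite !formE; apply: word_sum_linear. Qed.

Lemma form_linearr x : linear (@Defs.form k x : Λ' -> k^o).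
Proof.
move=> a y y'; rewrite !formE scaler_sumr -big_split; apply: eq_bigr => u _ /=.
by rewrite word_sum_linear scalerDr !scalerA mulrC.
Qed.

Lemma form_homogeneous n x w : deg' n x -> word_weight w != n -> Defs.form x << w >> = 0.
Proof.
move=> dx wn; rewrite formE /word_sum big_seq big1 // => u /dx un.
rewrite [X in _ *: X]word_sumU /form_h ifF ?scaler0 //.
by apply: contra_neqF wn => /eqP E; rewrite /word_weight -E un.
Qed.

(** Against a word of weight n the whole sum pairs as [c n] does; against a word of any other weight
    [c n] pairs to 0. *)
Lemma radical_homogeneous (s : seq int) (c : int -> Λ') : uniq s ->
  (forall n, deg' n (c n)) -> radical (\sum_(n <- s) c n) ->
  forall n, n \in s -> radical (c n).
Proof.
move=> us dc rad n ns y; have linr := form_linearr (c n).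
elim/malg_word_ind: y => [|a y z IHy IHz|w]; first by rewrite (linear_forE linr).
  by rewrite linr IHy IHz scaler0 addr0.
have [wn|wn] := eqVneq (word_weight w) n; last exact: form_homogeneous (dc n) wn.
have := rad << w >>; rewrite (linear_for_sum _ _ (form_linearl << w >>)).
rewrite (bigD1_seq n) //= big1 ?addr0 // => m mn.
by apply: form_homogeneous (dc m) _; rewrite wn eq_sym.
Qed.

End FreeAlgebraWords.

(** * The quotient by the radical *)

Section Quotient.
Context (k : comNzRingType) (L : algType k) (pi : {lrmorphism Lambda' k -> L}).
Hypothesis pi_surj : forall y : L, exists x, pi x = y.
Hypothesis pi_ker : forall x, pi x = 0 <-> radical x.
Local Notation deg := (induced_deg pi).

Lemma induced_grading : is_grading deg.
Proof.
have gr := deg'_grading k; split=> [n|n a x y [x' dx <-] [y' dy <-]|y|s c us dc sc0 n ns].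
- by exists 0; [apply: (deg0 gr) | rewrite linear0].
- by exists (a *: x' + y'); [apply: (degP gr) | rewrite linearP].
- have [x <-] := pi_surj y; case: gr => _ _ /(_ x)[s [c [dc ->]]] _.
  exists s, (pi \o c); split=> [n|]; last by rewrite linear_sum.
  by exists (c n).
(* Homogeneous lifts of the components turn a vanishing sum in [L] into an element of the radical,
   and the radical is graded. *)
have /choice[c' dc'] : forall n, exists x, deg' n x /\ pi x = c n.
  by move=> m; have [x dx <-] := dc m; exists x.
have [_ <-] := dc' n; apply/pi_ker; apply: radical_homogeneous us _ _ _ ns.
  by move=> m; have [] := dc' m.
apply/pi_ker; rewrite linear_sum -[RHS]sc0; apply: eq_bigr => m _.
by have [] := dc' m.
Qed.

Lemma induced_deg1 : deg 0 1.
Proof. by exists 1; [apply: deg'1 | apply: rmorph1]. Qed.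

Lemma induced_degM m n x y : deg m x -> deg n y -> deg (m + n) (x * y).
Proof.
by move=> [x' dx <-] [y' dy <-]; exists (x' * y'); [apply: deg'M | rewrite rmorphM].
Qed.

Variable h : nat -> L.
Hypothesis h_def : forall n, h n = pi (h' n).

Lemma induced_deg_h n : deg n%:Z (h n).
Proof. by exists (h' n); [apply: deg'_h|]. Qed.

Lemma pi_word w : pi << w >> = comp_prod h (composition_of w).
Proof.
rewrite word_comp_prod /comp_prod rmorph_prod.
by apply: eq_bigr => n _; rewrite h_def.
Qed.

Lemma span_words n (T : L -> Prop) : T 0 ->
  (forall a x y, T x -> T y -> T (a *: x + y)) ->
  (forall al, (sumn al)%:Z = n -> T (comp_prod h al)) -> forall x, deg n x -> T x.
Proof.
move=> T0 Tlin Tw _ [x dx <-].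
apply: (malg_supp_ind (T := fun x => T (pi x))) => [|a y z Ty Tz|w wx].
- by rewrite linear0.
- by rewrite linearP; apply: Tlin.
- by rewrite pi_word; apply: Tw; apply: dx.
Qed.

Variable Delta : L -> (L ⊗ L)%type.
Hypothesis Delta_induced : forall x, Delta (pi x) = tensor_map pi pi (Delta' x).

Lemma Delta_linear : linear Delta.
Proof.
move=> a x y; have [x' <-] := pi_surj x; have [y' <-] := pi_surj y.
by rewrite -linearP !Delta_induced Delta'_linear linearP.
Qed.

Lemma induced_Delta1 : Delta 1 = 1 ⊗ 1.
Proof.
rewrite -(rmorph1 pi) Delta_induced.
by rewrite malg1E Delta'_word /composition_of fm1 /= tensor_mapE.
Qed.

(** Both sides are linear in a preimage of x, so words suffice. On words [Delta'] is a fold over the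
    letters, so the first letter splits off by definition; [pi] preserves degrees and hence commutes
    with the twists. *)
Lemma induced_Delta_h n x : (0 < n)%N ->
  Delta (h n * x) = Delta_h_mul induced_grading h n (Delta x).
Proof.
case: n => // n _; have [y <-] := pi_surj x; rewrite h_def -rmorphM !Delta_induced.
apply: (malg_linear_ext
  (f := fun y => tensor_map pi pi (Delta' (h' n.+1 * y)))
  (g := fun y => Delta_h_mul induced_grading h n.+1 (tensor_map pi pi (Delta' y)))).
- by move=> a u v; rewrite mulrDr -malg_scalerAr Delta'_linear linearP.
- by move=> a u v; rewrite Delta'_linear !linearP.
move=> w; rewrite h'_word !Delta'_word {1}/composition_of fmM fmU /=.
set t := foldr _ _ _.
rewrite /Delta'_gen (tensor_mul_sum (deg'_grading k)) linear_sum; apply: eq_bigr => m _.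
rewrite (tensor_mulE (deg'_grading k) _ _ (@deg'_h k _)) /= !tensor_map_comp.
apply: eq_tensor_map => z /=; rewrite /twisted_mul rmorphM /= -!h_def; congr (_ * _).
by rewrite (parity_morph (deg'_grading k) induced_grading) // => i u du; exists u.
Qed.

End Quotient.

(** * Inverses of power series over a noncommutative ring *)

Section SeriesInverse.
Context (R : nzRingType).
Implicit Types a b c : nat -> R.

(** Sequences stand for power series in a central variable. Only positive degrees are constrained
    here; the constant terms are set to 1 in the lemmas. *)
Definition left_inverse_series a b :=
  forall n, (0 < n)%N -> \sum_(m < n.+1) a m * b (n - m)%N = 0.

(* The convolution c of b and a satisfies c b = b (a b) = b, and b is invertible. *)
Lemma left_inverse_series_sym a b : a 0%N = 1 -> b 0%N = 1 ->
  left_inverse_series a b -> left_inverse_series b a.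
Proof.
move=> a0 b0 ab n; pose c n := \sum_(m < n.+1) b m * a (n - m)%N.
have c0 : c 0%N = 1 by rewrite /c big_ord1 a0 b0 mulr1.
have cb N : \sum_(m < N.+1) c m * b (N - m)%N = b N.
  under eq_bigr => m _.
    rewrite mulr_suml.
    under eq_bigr => j _ do rewrite -mulrA.
    over.
  pose G j m := b j * (a (m - j)%N * b (N - m)%N).
  rewrite (big_triangle N G) big_ord_recr /= subnn big_ord1 /G addn0 !subnn a0 b0 !mulr1.
  rewrite big1 ?add0r // => j _; under eq_bigr => l _ do rewrite addKn subnDA.
  by rewrite -mulr_sumr ab ?mulr0 // subn_gt0.
elim/ltn_ind: n => -[//|n] IH _; rewrite -/(c n.+1).
have := cb n.+1; rewrite big_ord_recr big_ord_recl /= c0 mul1r subn0 subnn b0 mulr1.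
rewrite big1 ?addr0 => [|i _]; last first.
  by rewrite /bump leq0n add1n [c _]IH ?mul0r // ltnS ltn_ord.
by move=> E; apply: (addrI (b n.+1)); rewrite addr0.
Qed.

(** As b_0 = 1, the coefficient of degree n + 1 determines a_(n+1) from the earlier terms of a. *)
Lemma left_inverse_series_uniq a c b : a 0%N = 1 -> c 0%N = 1 -> b 0%N = 1 ->
  left_inverse_series a b -> left_inverse_series c b -> a =1 c.
Proof.
move=> a0 c0 b0 ab cb; elim/ltn_ind => -[|n] IH; first by rewrite a0 c0.
apply: (@addrI _ (\sum_(m < n.+1) a m * b (n.+1 - m)%N)).
have := ab n.+1 isT; rewrite big_ord_recr /= subnn b0 mulr1 => ->.
have := cb n.+1 isT; rewrite big_ord_recr /= subnn b0 mulr1 => E.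
by rewrite -{1}E; congr (_ + _); apply: eq_bigr => m _; rewrite IH.
Qed.

End SeriesInverse.

(** * Signs and binomial coefficients *)

Lemma mulr_signE (k : pzRingType) (A : lalgType k) n (x : A) :
  (-1) ^+ n * x = (-1) ^+ n *: x.
Proof.
rewrite -signr_odd -[in RHS]signr_odd; case: odd.
  by rewrite mulN1r scaleN1r.
by rewrite mul1r scale1r.
Qed.

Lemma binS2 n : 'C(n.+1, 2) = ('C(n, 2) + n)%N.
Proof. by rewrite binS bin1. Qed.

(** The term m n is the sign exponent of an anti-homomorphism in degrees m and n. It makes the sign
    of S(h_λ) depend on |λ| only. *)
Lemma binS2D m n : 'C((m + n).+1, 2) = (m * n + 'C(m.+1, 2) + 'C(n.+1, 2))%N.
Proof.
elim: m => [|m IH]; first by rewrite mul0n.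
rewrite addSn binS2 IH [in RHS]binS2 mulSn; rewrite -addSn (addnC m.+1).
by rewrite addnAC [(_ + (n + _))%N]addnACA [(m * n + n)%N]addnC.
Qed.

Lemma rmorph_comp_prod (A : nzRingType) (f : {rmorphism A -> A}) (u v : nat -> A) la :
  (forall n, f (u n) = (-1) ^+ 'C(n.+1, 2) * v n) ->
  f (comp_prod u la) = (-1) ^+ (comp_bin2 la + sumn la) * comp_prod v la.
Proof.
move=> fu; elim: la => [|n la IH].
  by rewrite /comp_prod /comp_bin2 !big_nil rmorph1 mulr1.
rewrite /comp_prod /comp_bin2 !big_cons rmorphM fu [f _]IH /= addnACA -binS2 [in RHS]exprD.
by rewrite -!mulrA; congr (_ * _); rewrite !mulrA; congr (_ * _); rewrite commr_sign.
Qed.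

(** * Double cosets for a composition with one part *)

Lemma reshape_index1 n i : (i < n)%N -> reshape_index [:: n] i = 0%N.
Proof. by move=> lin; rewrite /reshape_index /= subn_eq0 lin. Qed.

Lemma Young1 n : Young n [:: n] = [set: 'S_n].
Proof.
by apply/setP => s; rewrite !inE; apply/forallP => i; rewrite !reshape_index1.
Qed.

Lemma double_cosets1 n be : double_cosets n be [:: n] = [set [set: 'S_n]].
Proof.
have E w : (Young n be * [set w] * Young n [:: n])%g = [set: 'S_n].
  apply/setP => x; rewrite Young1 inE.
  have -> : x = (1 * w * (w^-1 * x))%g by rewrite mul1g mulKVg.
  apply: mem_mulg; first apply: mem_mulg; rewrite ?inE //.
  by apply/forallP => i; rewrite perm1.
apply/setP => c; rewrite inE; apply/imsetP/eqP => [[w _ ->]|->] //.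
by exists 1%g.
Qed.

Lemma Coxeter_length1 n : Coxeter_length (1%g : 'S_n) = 0%N.
Proof.
rewrite /Coxeter_length; case: ex_minnP => m _ /(_ 0%N); rewrite leqn0 => H.
apply/eqP/H/existsP; exists [ffun=> 1%g]; rewrite big_ord0 eqxx andbT.
by apply/forallP => -[].
Qed.

Lemma double_coset_lengthT n : double_coset_length [set: 'S_n] = 0%N.
Proof.
rewrite /double_coset_length; case: arg_minnP => [|w _ /(_ 1%g)].
  by rewrite inE.
by rewrite inE Coxeter_length1 leqn0 => /(_ isT)/eqP.
Qed.

(** For a single part, S_alpha is the whole symmetric group, so there is one double coset and its
    shortest element is the identity. With [be] = (1, 1) this shows that h_1 h_1 pairs to 1 with
    h_2. *)
Lemma form_h1 (k : comNzRingType) be : form_h k be [:: sumn be] = 1.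
Proof.
by rewrite /form_h /= addn0 eqxx double_cosets1 big_set1 double_coset_lengthT.
Qed.

(** * The antipode and the map ψ1 ψ2 on Λ *)

Theorem proposition2p17
  (k : comNzRingType)
  (L : algType k) (pi : {lrmorphism Lambda' k -> L})
  (pi_surj : forall y : L, exists x, pi x = y)
  (pi_ker : forall x, pi x = 0 <-> radical x)
  (Delta : L -> L ⊗ L)
  (Delta_induced : forall x, Delta (pi x) = tensor_map pi pi (Delta' x))
  (eps : L -> k)
  (eps_induced : forall x, eps (pi x) = eps' x)
  (h : nat -> L) (h_def : forall n, h n = pi (h' n))
  (e : nat -> L) (e0 : e 0%N = 1)
  (e_rec : forall n, (0 < n)%N ->
     \sum_(j < n.+1) (-1) ^+ 'C(j.+1, 2) * (e j * h (n - j)%N) = 0)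
  (psi1 : {lrmorphism L -> L}) (psi1_h : forall n, psi1 (h n) = e n)
  (psi2 : {lrmorphism L -> L})
  (psi2_h : forall n, psi2 (h n) = (-1) ^+ 'C(n.+1, 2) * h n)
  (psi3 : {linear L -> L}) (psi3_h : forall n, psi3 (h n) = h n)
  (psi3_anti : forall m n x y, induced_deg pi m x -> induced_deg pi n y ->
     psi3 (x * y) = (-1) ^+ `|(m * n)%R|%N * (psi3 y * psi3 x)) :
  let S := psi1 \o psi2 \o psi3 in
  [/\ graded_Hopf_superalgebra (induced_deg pi) Delta eps S,
      (2%:R != 0 :> k -> S \o S <> id)
    & forall la : seq nat, is_partition la ->
      [/\ psi1 (psi2 (comp_prod h la)) =
             (-1) ^+ (comp_bin2 la + sumn la) * comp_prod e la,
          psi1 (psi2 (comp_prod e la)) =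
             (-1) ^+ (comp_bin2 la + sumn la) * comp_prod h la
        & S (comp_prod h la) =
             (-1) ^+ 'C((sumn la).+1, 2) * comp_prod e (rev la)]].
Proof.
move=> S; have gr := induced_grading pi_surj pi_ker.
have h0 : h 0%N = 1 by rewrite h_def rmorph1.
pose phi : {rmorphism L -> L} := psi1 \o psi2.
have phi_h n : phi (h n) = (-1) ^+ 'C(n.+1, 2) * e n.
  by rewrite /= psi2_h rmorphM rmorph_sign /= psi1_h.
(* The signs in φ(h_n) are those of the recursion for e_n, which thus says that the series of φ(h_n)
   is a left inverse of the series of h_n. *)
have phih_h : left_inverse_series (phi \o h) h.
  move=> n n_gt0; rewrite -[RHS](e_rec n n_gt0); apply: eq_bigr => m _.
  by rewrite [(phi \o h) _]phi_h mulrA.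
have h_phih : left_inverse_series h (phi \o h).
  by apply: left_inverse_series_sym => //; rewrite /= h0 !rmorph1.
(* Applying φ to [phih_h] makes φ(φ(h)) a left inverse of φ(h); by [h_phih] so is h, and left
   inverses are unique. *)
have phiK n : phi (phi (h n)) = h n.
  apply: (@left_inverse_series_uniq _ (phi \o phi \o h) h (phi \o h)) => //.
  - by rewrite /= h0 !rmorph1.
  - by rewrite /= h0 !rmorph1.
  move=> m m_gt0; have := congr1 phi (phih_h m m_gt0); rewrite rmorph0 rmorph_sum => E.
  by rewrite -[RHS]E; apply: eq_bigr => i _; rewrite rmorphM.
have phi_e n : phi (e n) = (-1) ^+ 'C(n.+1, 2) * h n.
  rewrite -[in RHS]phiK phi_h rmorphM rmorph_sign mulrA -exprD.
  by rewrite addnn -signr_odd odd_double mul1r.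
have S1 : S 1 = 1 by rewrite /S /= -h0 psi3_h h0 !rmorph1.
have S_h n : S (h n) = phi (h n) by rewrite /S /= psi3_h.
have S_antih n x : S (h n * x) = S (iter n (parity gr) x) * S (h n).
  have lS : linear S by apply: linearP.
  elim/(homogeneous_ind gr): x => [x y IHx IHy|m x dx].
    by rewrite mulrDr !linearD !(linear_forE lS) IHx IHy mulrDl.
  rewrite (iter_parity_homogeneous gr _ dx) (linear_forE lS) -scalerAl.
  rewrite {1}/S /= (psi3_anti _ _ _ _ (induced_deg_h h_def n) dx) abszM.
  by rewrite !rmorphM !rmorph_sign mulr_signE.
have S_word la : S (comp_prod h la) = (-1) ^+ 'C((sumn la).+1, 2) * comp_prod e (rev la).
  elim: la => [|n la IH]; first by rewrite /comp_prod !big_nil mulr1.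
  rewrite comp_prod_cons S_antih.
  have dw := deg_word (induced_deg1 pi) (induced_degM (pi := pi)) (induced_deg_h h_def) la.
  rewrite (iter_parity_homogeneous gr _ dw).
  have lS : linear S by apply: linearP.
  rewrite (linear_forE lS) IH S_h phi_h rev_cons /comp_prod big_rcons.
  rewrite !mulr_signE -!scalerAl -scalerAr !scalerA -!exprD.
  by congr (_ ^+ _ *: _); rewrite addnAC -binS2D.
have deg_e n : induced_deg pi n%:Z (e n).
  elim/ltn_ind: n => -[|n] IH; first by rewrite e0; apply: induced_deg1.
  have := e_rec n.+1 isT; rewrite big_ord_recr /= subnn h0 mulr1 => /eqP.
  rewrite addrC addr_eq0 => /eqP E.
  (* The recursion is solved for its last term, whose sign is its own inverse. *)
  have -> : e n.+1 = (-1) ^+ 'C(n.+2, 2) *: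
      - (\sum_(j < n.+1) (-1) ^+ 'C(j.+1, 2) * (e j * h (n.+1 - j)%N)).
    rewrite -E -mulr_signE mulrA -exprD.
    by rewrite addnn -signr_odd odd_double mul1r.
  apply: (degZ gr); rewrite -scaleN1r; apply: (degZ gr); apply: (deg_sum gr) => j _.
  rewrite mulr_signE; apply: (degZ gr).
  have -> : n.+1%:Z = j%:Z + (n.+1 - j)%:Z by rewrite -PoszD subnKC // ltnW.
  by apply: induced_degM; [apply: IH | apply: induced_deg_h].
have deg_S n x : induced_deg pi n x -> induced_deg pi n (S x).
  move: x; apply: (span_words h_def) => [|a x y dx dy|la <-].
  - by rewrite /S /= !linear0; apply: (deg0 gr).
  - by rewrite /S /= !linearP; apply: (degP gr).
  rewrite S_word mulr_signE; apply: (degZ gr); rewrite -sumn_rev.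
  exact: (deg_word (induced_deg1 pi) (induced_degM (pi := pi)) deg_e).
(* [Delta] and [eps] are given as bare functions; their linearity descends along the surjection
   [pi]. *)
pose DeltaL : {linear L -> (L ⊗ L)%type} := HB.pack Delta
  (GRing.isLinear.Build k L (L ⊗ L)%type *:%R Delta (Delta_linear pi_surj Delta_induced)).
have eps_linear : scalar eps.
  move=> a x y; have [x' <-] := pi_surj x; have [y' <-] := pi_surj y.
  by rewrite -linearP !eps_induced /eps' mcoeffD mcoeffZ.
pose epsL : {scalar L} := HB.pack eps (GRing.isLinear.Build k L k *%R eps eps_linear).
split.
- apply: (@graded_Hopf_of_generators k L _ gr (induced_deg1 pi) (induced_degM (pi:=pi)) h h0
    (induced_deg_h h_def) (span_words h_def) DeltaL _ _ epsL _ _ (psi1 \o psi2 \o psi3)) => //.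
  + exact: (induced_Delta1 Delta_induced).
  + exact: (induced_Delta_h pi_surj pi_ker h_def Delta_induced).
  + by rewrite /= -(rmorph1 pi) eps_induced /eps' mcoeff1 eqxx.
  + move=> n _ [x dx <-] n0; rewrite /= eps_induced; move/deg'P: dx; apply.
    by rewrite /word_weight /composition_of fm1 eq_sym.
  + move=> n n_gt0; rewrite -[RHS](phih_h n n_gt0); apply: eq_bigr => m _.
    by congr (_ * _); apply: S_h.
  + move=> n n_gt0; rewrite -[RHS](h_phih n n_gt0); apply: eq_bigr => m _.
    by congr (_ * _); apply: S_h.
- move=> two_neq0 /(congr1 (fun f => f (h 2%N))) /=; apply/eqP.
  have e1 : e 1%N = h 1%N.
    have := e_rec 1%N isT; rewrite !big_ord_recr big_ord0 /= e0 h0 add0r !mul1r mulr1.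
    by rewrite mulN1r => /eqP; rewrite subr_eq0 => /eqP.
  have sgn3 : (-1) ^+ 'C(3, 2) = -1 :> L by rewrite -signr_odd.
  have e2 : e 2%N = h 2%N - h 1%N * h 1%N.
    have := e_rec 2%N isT; rewrite !big_ord_recr big_ord0 /= e0 h0 add0r !mul1r mulr1.
    by rewrite sgn3 !mulN1r e1 => /eqP; rewrite subr_eq0 => /eqP.
  have S_hh : S (h 1%N * h 1%N) = - (h 1%N * h 1%N).
    have := S_word [:: 1; 1]%N; rewrite /comp_prod !big_cons !big_nil !mulr1 => ->.
    by rewrite sgn3 mulN1r e1.
  (* S(h_2) = -e_2 = h_1^2 - h_2, and S sends this to -h_1^2 + e_2, where e_2 = h_2 - h_1^2. *)
  have SS : S (S (h 2%N)) = h 2%N - (h 1%N * h 1%N) *+ 2.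
    have lS : linear S by apply: linearP.
    rewrite S_h phi_h sgn3 mulN1r -scaleN1r (linear_forE lS) e2.
    rewrite -[X in h _ + X]scaleN1r !(linear_forE lS) S_h phi_h sgn3 S_hh e2.
    by rewrite !scaleN1r mulN1r opprK opprD opprK -addrA -opprD -mulr2n.
  (* If S^2 fixed h_2, then 2 h_1^2 would vanish in [L], so its lift would lie in the radical. *)
  rewrite SS; apply: contraNneq two_neq0 => /eqP.
  rewrite -subr_eq0 addrAC subrr sub0r oppr_eq0 => /eqP hh0.
  have rad : radical (2%:R *: (h' 1 * h' 1) : Lambda' k).
    by apply/pi_ker; rewrite linearZ rmorphM /= scaler_nat -[RHS]hh0 h_def.
  (* The letter 1 is the generator h_2. Pairing with it gives 2 (h_1 h_1, h_2) = 2, which forces 2 =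
     0 in [k]. *)
  have := rad << fmu 1%N >>; rewrite (linear_forE (form_linearl _)).
  rewrite [h' 1 * _]malg_wordM form_word /composition_of fmM !fmU /=.
  by rewrite (form_h1 k [:: 1; 1]%N) => /eqP; rewrite [_ *: _]mulr1.
- move=> la _; split; last exact: S_word.
    exact: (rmorph_comp_prod (f := phi)).
  exact: (rmorph_comp_prod (f := phi)).
Qed.
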